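(* Let $\{\tau_t=e^{t\mathcal{L}}\}_{t\ge0}$ be a quantum Markov semigroup of quantum channels on $\mathbb{M}_d$ with generator $\mathcal{L}$. Then the following statements are equivalent: (1) $\{\tau_t\}$ is eventually mixed twisted dephasing; (2) $\{\tau_t\}$ is eventually entanglement breaking; (3) $\{\tau_t\}$ is eventually PPT; (4) $\{\tau_t\}$ is eventually $2$-copositive; (5) the peripheral Poisson boundary is trivial, that is, $\mathcal{P}(\mathcal{L})=\mathbb{C}I_d$; (6) $\{\tau_t\}$ is primitive; (7) $\lim_{t\to\infty}\tau_t=\delta_d$.
   Context: $\mathbb{M}_d$ is the algebra of $d\times d$ complex matrices, $\mathrm{id}_d$ the identity map on $\mathbb{M}_d$, $T$ the transpose map on $\mathbb{M}_d$, $\mathbb{U}(d)$ the unitary group in $\mathbb{M}_d$. A quantum channel on $\mathbb{M}_d$ is a completely positive (CP), trace-preserving linear map. A one-parameter semigroup on $\mathbb{M}_d$ is a family of linear maps $\{\tau_t\}_{t\ge0}$ on $\mathbb{M}_d$ with $\tau_0=\mathrm{id}_d$, $\tau_t\circ\tau_s=\tau_{t+s}$ and $t\mapsto\tau_t$ continuous; it is of the form $\tau_t=e^{t\mathcal{L}}$ with generator $\mathcal{L}=\lim_{t\to0+}(\tau_t-\mathrm{id}_d)/t$. It is a quantum Markov semigroup if each $\tau_t$ is unital and CP; ''of quantum channels'' means that in addition each $\tau_t$ is trace-preserving. A linear map $\varphi$ on $\mathbb{M}_d$ is: $k$-copositive if $(\varphi\circ T)\otimes \mathrm{id}_k$ is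 positive; completely copositive if it is $k$-copositive for all $k\ge1$; PPT if it is CP and completely copositive; entanglement breaking (EB) if for every $k\ge 1$ and every positive semidefinite $Z\in\mathbb{M}_d\otimes\mathbb{M}_k$, $(\varphi\otimes\mathrm{id}_k)(Z)$ is separable, i.e. a finite sum of $X_j\otimes Y_j$ with $X_j,Y_j$ positive semidefinite. For $U\in\mathbb{M}_d$, $\mathrm{Ad}_U(X)=UXU^*$. The completely dephasing channel is $\Delta_d(X)=\sum_{j=1}^d\langle e_j,Xe_j\rangle|e_j\rangle\langle e_j|$, with $\{e_j\}$ the standard basis of $\mathbb{C}^d$. For $U,V\in\mathbb{U}(d)$, the twisted dephasing channel is $\beta_{U,V}=\mathrm{Ad}_U\circ\Delta_d\circ\mathrm{Ad}_{V^*}$. A mixed twisted dephasing (MTD) channel is a finite convex combination of twisted dephasing channels. For each of the properties MTD, EB, PPT, $2$-copositive, the semigroup $\{\tau_t\}$ ''eventually'' has the property if there is $t_0>0$ such that $\tau_t$ has it for every $t\ge t_0$. The peripheral Poisson boundary is $\mathcal{P}(\mathcal{L})=\mathrm{span}\{X\in\mathbb{M}_d:\mathcal{L}(X)=iaX\text{ for some }a\in\mathbb{R}\}$. The semigroup is primitive if there exists a unique, strictly positive density matrix $\rho\in\mathbb{M}_d$ (positive with trace one) such that $\tau_t^*(\rho)=\rho$ for all $t\ge0$, where $\tau_t^*$ is the adjoint with respect to the Hilbert-Schmidt inner product $\langle X,Y\rangle=\mathrm{Tr}(X^*Y)$. The completely depolarizing channel is $\delta_d(X)=\frac{\mathrm{Tr}(X)}{d}I_d$.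 *)

(* Defs.v *)
From HB Require Import structures.
From mathcomp Require Import all_boot all_order all_algebra.
From mathcomp Require Import sesquilinear spectral mxtens complex.
From mathcomp Require Import all_classical all_reals all_analysis.

Set Implicit Arguments.
Unset Strict Implicit.
Unset Printing Implicit Defensive.

Import Order.TTheory GRing.Theory Num.Theory.
Import numFieldNormedType.Exports.

Local Open Scope ring_scope.
Local Open Scope classical_set_scope.
Local Open Scope complex_scope.
Local Open Scope sesquilinear_scope.

(* The topology and norm of [R[i]] are those given by the complex modulus;
   ['M[R[i]]_d] then gets the entrywise topology. *)
HB.instance Definition _ (R : realType) := PseudoPointedMetric.copy R[i] R[i]^o.
HB.instance Definition _ (R : realType) := NormedModule.copy R[i] R[i]^o.

Section Matrices.
Variables (R : realType) (n : nat).
Implicit Types A X Y : 'M[R[i]]_n.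

(* In the order of [R[i]], [0 <= z] means that [z] is real and nonnegative, so
   this forces [A] to be Hermitian. *)
Definition psdmx A := forall v : 'cV[R[i]]_n, 0 <= (v^t* *m A *m v) 0 0.

Definition pdmx A :=
  forall v : 'cV[R[i]]_n, v != 0 -> 0 < (v^t* *m A *m v) 0 0.

Definition density A := psdmx A /\ \tr A = 1.

Definition hs_inner X Y : R[i] := \tr (X^t* *m Y).

End Matrices.

Section Maps.
Variables (R : realType) (d : nat).
Local Notation Md := 'M[R[i]]_d.
Implicit Types (phi : {linear Md -> Md}) (X Y U V : Md).

Definition positive_map m n (f : 'M[R[i]]_m -> 'M[R[i]]_n) :=
  forall A, psdmx A -> psdmx (f A).

(* Block (a, b) of an element of M_d (x) M_k, viewed as a k x k matrix with
   entries in M_d; [A *t B] is the Kronecker product of [A] and [B]. *)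
Definition tens_block k (Z : 'M[R[i]]_(d * k)) (a b : 'I_k) : Md :=
  \matrix_(i, j) Z (mxtens_index (i, a)) (mxtens_index (j, b)).

(* phi (x) id_k *)
Definition tens_id phi k (Z : 'M[R[i]]_(d * k)) : 'M[R[i]]_(d * k) :=
  \sum_(a < k) \sum_(b < k) phi (tens_block Z a b) *t delta_mx a b.

Lemma tens_idE phi k X (Y : 'M[R[i]]_k) : tens_id phi (X *t Y) = phi X *t Y.
Proof.
apply/matrixP => p q.
have [i a] := mxtens_indexP p; have [j b] := mxtens_indexP q.
rewrite /tens_id tensmxE summxE (bigD1 a) //= summxE (bigD1 b) //=.
rewrite tensmxE mxE !eqxx mulr1 big1 => [|b' nb]; last first.
  by rewrite tensmxE mxE eqxx [b == _]eq_sym (negPf nb) mulr0.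
rewrite addr0 big1 => [|a' na]; last first.
  rewrite summxE big1 // => b' _.
  by rewrite tensmxE mxE [a == _]eq_sym (negPf na) mulr0.
have -> : tens_block (X *t Y) a b = Y a b *: X.
  by apply/matrixP => i' j'; rewrite !mxE !mxtens_indexK /= mulrC.
by rewrite addr0 linearZ mxE mulrC.
Qed.

Definition completely_positive phi :=
  forall k, (0 < k)%N -> positive_map (@tens_id phi k).

Definition copositive k phi :=
  positive_map (@tens_id (phi \o trmx : {linear Md -> Md}) k).

Definition completely_copositive phi := forall k, (0 < k)%N -> copositive k phi.

Definition PPT phi := completely_positive phi /\ completely_copositive phi.

Definition separable k (Z : 'M[R[i]]_(d * k)) :=
  exists (m : nat) (X : 'I_m -> Md) (Y : 'I_m -> 'M[R[i]]_k),
    (forall j, psdmx (X j) /\ psdmx (Y j)) /\ Z = \sum_(j < m) X j *t Y j.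

Definition entanglement_breaking phi :=
  forall k (Z : 'M[R[i]]_(d * k)),
    (0 < k)%N -> psdmx Z -> separable (tens_id phi Z).

Definition unital phi := phi 1%:M = 1%:M.

Definition trace_preserving phi := forall X, \tr (phi X) = \tr X.

Definition Ad U X := U *m X *m U^t*.

Definition dephasing X : Md := \sum_(j < d) X j j *: delta_mx j j.

Definition twisted_dephasing U V X := Ad U (dephasing (Ad (V^t*) X)).

Definition mixed_twisted_dephasing phi :=
  exists (m : nat) (p : 'I_m -> R) (U V : 'I_m -> Md),
    [/\ forall j, 0 <= p j,
        \sum_(j < m) p j = 1,
        forall j, U j \is unitarymx /\ V j \is unitarymx &
        forall X, phi X = \sum_(j < m) (p j)%:C *: twisted_dephasing (U j) (V j) X].

Definition depolarizing X : Md := (\tr X / d%:R) *: 1%:M.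

Definition hs_adjoint phi Y : Md :=
  \matrix_(i, j) hs_inner (phi (delta_mx i j)) Y.

Lemma hs_adjointP phi X Y :
  hs_inner (phi X) Y = hs_inner X (hs_adjoint phi Y).
Proof.
have inE A B : hs_inner A B = \sum_i \sum_j (A i j)^* * B i j :> R[i].
  rewrite exchange_big; apply: eq_bigr => j _; rewrite mxE.
  by apply: eq_bigr => i _; rewrite !mxE.
have phiE i j : phi X i j = \sum_k \sum_l X k l * phi (delta_mx k l) i j.
  rewrite {1}(matrix_sum_delta X) linear_sum summxE; apply: eq_bigr => k _.
  by rewrite linear_sum summxE; apply: eq_bigr => l _; rewrite linearZ mxE.
rewrite !inE !pair_bigA /=.
transitivity (\sum_ij \sum_kl ((X kl.1 kl.2)^* *
    ((phi (delta_mx kl.1 kl.2) ij.1 ij.2)^* * Y ij.1 ij.2)) : R[i]).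
  apply: eq_bigr => ij _; rewrite phiE pair_bigA /= rmorph_sum mulr_suml.
  by apply: eq_bigr => kl _; rewrite rmorphM mulrA.
rewrite exchange_big; apply: eq_bigr => kl _.
by rewrite mxE inE pair_bigA mulr_sumr.
Qed.

Definition linear_span (S : set Md) : set Md :=
  [set X | exists (m : nat) (c : 'I_m -> R[i]) (Y : 'I_m -> Md),
     (forall j, S (Y j)) /\ X = \sum_(j < m) c j *: Y j].

Definition peripheral_poisson_boundary (L : {linear Md -> Md}) : set Md :=
  linear_span [set X | exists a : R, L X = ('i * a%:C) *: X].

End Maps.

Section Semigroups.
Variables (R : realType) (d : nat).
Local Notation Md := 'M[R[i]]_d.

(* A family (tau_t)_(t >= 0) is represented by a function on [R] of which only
   the restriction to the nonnegative reals is ever used.  Convergence and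
   continuity of a family of linear maps are stated pointwise: as ['M_d] is
   finite dimensional, this is convergence in any operator norm. *)
Implicit Types (tau : R -> {linear Md -> Md}) (L : {linear Md -> Md}).

Definition semigroup tau :=
  [/\ tau 0 =1 id,
      forall t s, 0 <= t -> 0 <= s -> tau (t + s) =1 tau t \o tau s &
      forall X, {within [set t | 0 <= t], continuous (fun t => tau t X)}].

Definition quantum_markov_semigroup tau :=
  semigroup tau /\
  forall t, 0 <= t -> unital (tau t) /\ completely_positive (tau t).

Definition generator tau L :=
  forall X, (t^-1)%:C *: (tau t X - X) @[t --> 0^'+] --> L X.

Definition eventually_has (P : {linear Md -> Md} -> Prop) tau :=
  exists2 t0 : R, 0 < t0 & forall t, t0 <= t -> P (tau t).

Definition invariant tau (rho : Md) :=
  forall t, 0 <= t -> hs_adjoint (tau t) rho = rho.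

(* The invariant density matrix is unique among all density matrices and is
   strictly positive. *)
Definition primitive tau :=
  exists rho : Md,
    [/\ density rho, pdmx rho, invariant tau rho &
        forall sigma, density sigma -> invariant tau sigma -> sigma = rho].

Definition tends_to_depolarizing tau :=
  forall X, tau t X @[t --> +oo] --> depolarizing X.

End Semigroups.

(* Main.v *)
(* Every tau_t is a contraction for the Hilbert-Schmidt norm, because the Schwarz
   inequality tau(X* X) >= tau(X)* tau(X) may be traced; it is multiplicative on
   the X whose norm it preserves (equality in Schwarz: multiplicative domain).

   2-copositive => trivial boundary: if L X = i a X then tau_t X = e^(i a t) X,
   so X lies in the multiplicative domains of both tau_t and tau_t o T, whence
   tau_t (X Y) = tau_t (Y X) for all Y; tau_t is injective, so X is central.

   Trivial boundary => primitive: a fixed point of the dual contraction tau_t* is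
   a fixed point of tau_t.

   Primitive => convergence: fixed points are scalars.  The isometric part
   {X : |tau_t X| = |X| for all t} is L-stable; were it to contain a traceless
   X != 0, it would contain a traceless eigenvector of L, which is a multiple of
   a unitary with all its powers eigenvectors too, and finiteness of the spectrum
   would force its eigenvalue to be 0, making it a scalar.  Hence all eigenvalues
   of tau_1 on traceless matrices lie inside the open unit disc.

   Convergence => mixed twisted dephasing: the cone spanned by the differences
   beta_(U,V) - delta contains tr(A .) B for all traceless Hermitian A and B, hence
   every small Hermitian-preserving perturbation of delta that kills the identity
   and the trace stays in the convex hull of the beta_(U,V). *)
Require Import Defs.
From HB Require Import structures.
From mathcomp Require Import all_boot all_order all_algebra.
From mathcomp Require Import sesquilinear spectral mxtens complex.
From mathcomp Require Import all_classical all_reals all_analysis.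
From mathcomp Require Import fingroup perm.
From mathcomp Require Import ring lra.

Set Implicit Arguments.
Unset Strict Implicit.
Unset Printing Implicit Defensive.

Import Order.TTheory GRing.Theory Num.Theory.
Import numFieldNormedType.Exports.

Local Open Scope ring_scope.
Local Open Scope classical_set_scope.
Local Open Scope complex_scope.
Local Open Scope sesquilinear_scope.

(** * Positive semidefinite matrices and their sesquilinear forms *)

Section Positivity.
Variable C : numClosedFieldType.

Lemma adjmxM m n p (A : 'M[C]_(m, n)) (B : 'M[C]_(n, p)) :
  (A *m B)^t* = B^t* *m A^t*.
Proof. by rewrite trmx_mul map_mxM. Qed.

Lemma adjmxD m n (A B : 'M[C]_(m, n)) : (A + B)^t* = A^t* + B^t*.
Proof. by rewrite linearD map_mxD. Qed.

Lemma adjmxN m n (A : 'M[C]_(m, n)) : (- A)^t* = - A^t*.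
Proof. by rewrite linearN map_mxN. Qed.

Lemma adjmxB m n (A B : 'M[C]_(m, n)) : (A - B)^t* = A^t* - B^t*.
Proof. by rewrite adjmxD adjmxN. Qed.

Lemma adjmxZ m n (c : C) (A : 'M[C]_(m, n)) : (c *: A)^t* = Num.conj c *: A^t*.
Proof. by apply/matrixP => i j; rewrite !mxE rmorphM. Qed.

Lemma adjmx_sum m n I (r : seq I) (F : I -> 'M[C]_(m, n)) :
  (\sum_(i <- r) F i)^t* = \sum_(i <- r) (F i)^t*.
Proof.
elim/big_rec2: _ => [|i A B _ <-]; last exact: adjmxD.
by rewrite trmx0 map_mx0.
Qed.

Lemma adjmx1 n : (1%:M : 'M[C]_n)^t* = 1%:M.
Proof. by rewrite trmx1 map_mx1. Qed.

Lemma adjmx_delta m n (i : 'I_m) (j : 'I_n) :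
  (delta_mx i j : 'M[C]_(m, n))^t* = delta_mx j i.
Proof. by rewrite trmx_delta map_delta_mx. Qed.

Definition bform n (A : 'M[C]_n) (v w : 'cV[C]_n) : C := (v^t* *m A *m w) 0 0.

Lemma bformDl n (A B : 'M[C]_n) v w : bform (A + B) v w = bform A v w + bform B v w.
Proof. by rewrite /bform mulmxDr mulmxDl mxE. Qed.

Lemma bformNl n (A : 'M[C]_n) v w : bform (- A) v w = - bform A v w.
Proof. by rewrite /bform mulmxN mulNmx mxE. Qed.

Lemma bformZl n c (A : 'M[C]_n) v w : bform (c *: A) v w = c * bform A v w.
Proof. by rewrite /bform -scalemxAr -scalemxAl mxE. Qed.

Lemma bform0 n (v w : 'cV[C]_n) : bform 0 v w = 0.
Proof. by rewrite /bform mulmx0 mul0mx mxE. Qed.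

Lemma bform_add n (A : 'M[C]_n) (u u' v v' : 'cV[C]_n) :
  bform A (u + u') (v + v') = bform A u v + bform A u v' + bform A u' v + bform A u' v'.
Proof.
rewrite /bform adjmxD mulmxDl !mulmxDr !mulmxDl !mxE.
by rewrite -!addrA; congr (_ + _); rewrite addrCA.
Qed.

Lemma bformZ n (A : 'M[C]_n) b c (u v : 'cV[C]_n) :
  bform A (b *: u) (c *: v) = Num.conj b * c * bform A u v.
Proof.
by rewrite /bform adjmxZ -!scalemxAl -scalemxAr scalerA mxE.
Qed.

Lemma bform_mulmx n (A B D : 'M[C]_n) v w :
  bform (A^t* *m B *m D) v w = bform B (A *m v) (D *m w).
Proof. by rewrite /bform adjmxM !mulmxA. Qed.

Lemma bform_conj n (A : 'M[C]_n) v w : Num.conj (bform A v w) = bform (A^t*) w v.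
Proof.
by rewrite /bform -[in RHS](trmxCK v) -!adjmxM mulmxA !mxE.
Qed.

Lemma bform_delta n (A : 'M[C]_n) i j : bform A (delta_mx i 0) (delta_mx j 0) = A i j.
Proof. by rewrite /bform adjmx_delta -rowE -colE !mxE. Qed.

(** Polarization: testing on [e_i + c e_j] gives [c A_ij + conj c A_ji = 0], and the choices [c = 1]
    and [c = 'i] together force [A_ij = 0]. *)
Lemma bform_eq0 n (A : 'M[C]_n) : (forall v, bform A v v = 0) -> A = 0.
Proof.
move=> A0; apply/matrixP => i j; rewrite mxE.
have e c : c * A i j + Num.conj c * A j i = 0.
  have E1 : bform A (delta_mx i 0) (c *: delta_mx j 0) = c * A i j.
    by rewrite -[delta_mx i 0]scale1r bformZ rmorph1 mul1r bform_delta.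
  have E2 : bform A (c *: delta_mx j 0) (delta_mx i 0) = Num.conj c * A j i.
    by rewrite -[delta_mx i 0]scale1r bformZ mulr1 bform_delta.
  by have := A0 (delta_mx i 0 + c *: delta_mx j 0); rewrite bform_add E1 E2 !A0 add0r addr0.
have e1 := e 1; have ei := e ('i)%R; rewrite rmorph1 !mul1r in e1.
have ci : Num.conj ('i : C)%R = - ('i)%R.
  exact: conjCi.
move: ei; rewrite ci mulNr -mulrBr => /eqP; rewrite mulf_eq0 => /orP[|].
  by rewrite (negPf (neq0Ci _)).
rewrite subr_eq0 => /eqP ei; move: e1; rewrite -ei -mulr2n => /eqP.
by rewrite mulrn_eq0 => /eqP.
Qed.

(** At [C = R[i]] this unfolds to [psdmx]. *)
Definition psd n (A : 'M[C]_n) := forall v, 0 <= bform A v v.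

Lemma psd_herm n (A : 'M[C]_n) : psd A -> A^t* = A.
Proof.
move=> Ap; apply/eqP; rewrite -subr_eq0; apply/eqP/bform_eq0 => v.
rewrite bformDl bformNl -bform_conj.
by rewrite (CrealP (ger0_real (Ap v))) subrr.
Qed.

Lemma bform_gram n (A : 'M[C]_n) (v : 'cV[C]_n) : 0 <= bform (A^t* *m A) v v.
Proof.
rewrite -[A in _ *m A]mul1mx mulmxA bform_mulmx /bform mulmx1 mxE.
by apply: sumr_ge0 => i _; rewrite !mxE mulrC mul_conjC_ge0.
Qed.

Lemma psd_gram n (A : 'M[C]_n) : psd (A^t* *m A).
Proof. exact: bform_gram. Qed.

Lemma psd0 n : psd (0 : 'M[C]_n).
Proof. by move=> v; rewrite bform0. Qed.

Lemma psdD n (A B : 'M[C]_n) : psd A -> psd B -> psd (A + B).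
Proof. by move=> Ap Bp v; rewrite bformDl addr_ge0 ?Ap ?Bp. Qed.

Lemma psd_sum n I (r : seq I) (F : I -> 'M[C]_n) :
  (forall i, psd (F i)) -> psd (\sum_(i <- r) F i).
Proof.
move=> Fp; elim/big_rec: _ => [|i A _ Ap]; first exact: psd0.
exact: psdD.
Qed.

Lemma psdZ n (c : C) (A : 'M[C]_n) : 0 <= c -> psd A -> psd (c *: A).
Proof. by move=> c0 Ap v; rewrite bformZl mulr_ge0 ?Ap. Qed.

Lemma psd1 n : psd (1%:M : 'M[C]_n).
Proof. by rewrite -[1%:M]mulmx1 -[X in X *m _]adjmx1; exact: psd_gram. Qed.

Lemma psd_tr n (A : 'M[C]_n) : psd A -> psd A^T.
Proof.
move=> Ap v; pose w := map_mx Num.conj v.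
suff -> : bform A^T v v = bform A w w by exact: Ap.
rewrite /bform; have -> : v^t* *m A^T *m v = (w^t* *m A *m w)^T by [
  rewrite !trmx_mul mulmxA; congr (_ *m _ *m _);
  apply/matrixP => i j; rewrite !mxE ?conjCK].
by rewrite mxE.
Qed.

Lemma psd_diag_ge0 n (A : 'M[C]_n) i : psd A -> 0 <= A i i.
Proof. by move=> Ap; rewrite -bform_delta; exact: Ap. Qed.

Lemma psd_trace_ge0 n (A : 'M[C]_n) : psd A -> 0 <= \tr A.
Proof. by move=> Ap; apply: sumr_ge0 => i _; exact: psd_diag_ge0. Qed.

Lemma adjmx_unitary n (U : 'M[C]_n) : U \is unitarymx -> U^t* *m U = 1%:M.
Proof. by rewrite -trmxC_unitary => /unitarymxP; rewrite trmxCK. Qed.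

Lemma herm_spectral n (A : 'M[C]_n) : A^t* = A ->
  exists2 U : 'M[C]_n, U \is unitarymx &
  exists2 a : 'I_n -> C, forall j, a j \is Num.real &
    A = \sum_j a j *: (U *m delta_mx j j *m U^t*).
Proof.
move=> hA; have Aherm : A \is hermsymmx.
  by apply/is_hermitianmxP; rewrite expr0 scale1r hA.
exists ((spectralmx A)^t*); first by rewrite trmxC_unitary spectral_unitarymx.
exists (fun j => spectral_diag A 0 j) => [j|].
  by have /mxOverP/(_ 0 j) := hermitian_spectral_diag_real Aherm.
have /orthomx_spectralP eA := hermitian_normalmx Aherm.
rewrite trmxCK [LHS]eA invmx_unitary ?spectral_unitarymx //.
rewrite diag_mx_sum_delta mulmx_sumr mulmx_suml; apply: eq_bigr => j _.
by rewrite -scalemxAr -scalemxAl.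
Qed.

Lemma conj_delta_mul n (U : 'M[C]_n) i j : U \is unitarymx ->
  (U *m delta_mx i i *m U^t*) *m (U *m delta_mx j j *m U^t*) =
  (U *m delta_mx i i *m U^t*) *+ (i == j).
Proof.
move=> Uu; rewrite !mulmxA -(mulmxA _ (U^t*) U) adjmx_unitary // mulmx1.
rewrite -(mulmxA U) mul_delta_mx_cond; case: eqP => [->|_] //.
by rewrite !mulr0n mulmx0 mul0mx.
Qed.

Lemma conj_delta_herm n (U : 'M[C]_n) j :
  (U *m delta_mx j j *m U^t*)^t* = U *m delta_mx j j *m U^t*.
Proof. by rewrite !adjmxM trmxCK adjmx_delta mulmxA. Qed.

(** Square root by functional calculus: the eigenvalues [a j] are the values of the form at the
    vectors [U e_j], hence nonnegative, and [B] has the same spectral projections with eigenvalues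
    [sqrtC (a j)]. *)
Lemma psd_gramP n (A : 'M[C]_n) : psd A -> exists B : 'M[C]_n, A = B^t* *m B.
Proof.
move=> Ap; have [U Uu [a ar eA]] := herm_spectral (psd_herm Ap).
pose F j := U *m delta_mx j j *m U^t*.
have AF j : A *m F j = a j *: F j.
  rewrite eA mulmx_suml (bigD1 j) //= big1 ?addr0 => [|k kj].
    by rewrite -scalemxAl conj_delta_mul // eqxx.
  by rewrite -scalemxAl conj_delta_mul // (negPf kj) scaler0.
have a0 j : 0 <= a j.
  have := Ap (U *m delta_mx j 0); rewrite -bform_mulmx -(mulmxA _ A).
  have -> : A *m U = U *m (\sum_k a k *: delta_mx k k).
    rewrite {1}eA mulmx_suml mulmx_sumr; apply: eq_bigr => k _.
    by rewrite -scalemxAl -scalemxAr -!mulmxA adjmx_unitary // mulmx1.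
  rewrite mulmxA adjmx_unitary // mul1mx bform_delta summxE (bigD1 j) //=.
  rewrite big1 => [|k kj]; first by rewrite !mxE !eqxx mulr1 addr0.
  by rewrite !mxE eq_sym (negPf kj) mulr0.
exists (\sum_j sqrtC (a j) *: F j).
rewrite {1}eA adjmx_sum mulmx_suml; apply: eq_bigr => j _.
rewrite mulmx_sumr (bigD1 j) //= big1 => [|k kj]; rewrite adjmxZ conj_delta_herm.
  rewrite -scalemxAl -scalemxAr scalerA addr0 conj_delta_mul // eqxx.
  by rewrite (CrealP (ger0_real _)) ?sqrtC_ge0 // -expr2 sqrtCK.
by rewrite -scalemxAl -scalemxAr conj_delta_mul // eq_sym (negPf kj) !scaler0.
Qed.

End Positivity.

(** * Entanglement breaking and PPT maps *)

Section Blocks.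
Variables (C : numClosedFieldType) (d : nat).
Local Notation Md := 'M[C]_d.
Implicit Types (f : Md -> Md) (X Y : Md).

(* At C = R[i], tblock, tmap and tsep are convertible to tens_block, tens_id and
   separable. *)
Definition tblock k (Z : 'M[C]_(d * k)) (a b : 'I_k) : Md :=
  \matrix_(i, j) Z (mxtens_index (i, a)) (mxtens_index (j, b)).

Definition tmap f k (Z : 'M[C]_(d * k)) : 'M[C]_(d * k) :=
  \sum_(a < k) \sum_(b < k) f (tblock Z a b) *t delta_mx a b.

Definition tsep k (Z : 'M[C]_(d * k)) :=
  exists (m : nat) (X : 'I_m -> Md) (Y : 'I_m -> 'M[C]_k),
    (forall j, psd (X j) /\ psd (Y j)) /\ Z = \sum_(j < m) X j *t Y j.

(** Expanded form of [twisted_dephasing]: measure in the basis [V e_j], then prepare the projection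
    onto [U e_j]. *)
Definition tdeph (U V X : Md) : Md :=
  \sum_j (V^t* *m X *m V) j j *: (U *m delta_mx j j *m U^t*).

Lemma tblockK k (Z Z' : 'M[C]_(d * k)) :
  (forall a b, tblock Z a b = tblock Z' a b) -> Z = Z'.
Proof.
move=> eZ; apply/matrixP => p q.
have [i a] := mxtens_indexP p; have [j b] := mxtens_indexP q.
by have /matrixP/(_ i j) := eZ a b; rewrite !mxE.
Qed.

Lemma tblock_sum k I (r : seq I) (F : I -> 'M[C]_(d * k)) a b :
  tblock (\sum_(i <- r) F i) a b = \sum_(i <- r) tblock (F i) a b.
Proof.
apply/matrixP => i j; rewrite mxE !summxE; apply: eq_bigr => l _.
by rewrite mxE.
Qed.

Lemma tblock_tens k X (Y : 'M[C]_k) a b : tblock (X *t Y) a b = Y a b *: X.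
Proof. by apply/matrixP => i j; rewrite mxE tensmxE mxE mulrC. Qed.

Lemma tblock_id f k (Z : 'M[C]_(d * k)) a b :
  tblock (tmap f Z) a b = f (tblock Z a b).
Proof.
rewrite /tmap tblock_sum (bigD1 a) //= [X in _ + X]big1 => [|a' na].
  rewrite addr0 tblock_sum (bigD1 b) //= [X in _ + X]big1 => [|b' nb].
    by rewrite addr0 tblock_tens mxE !eqxx scale1r.
  by rewrite tblock_tens mxE eqxx eq_sym (negPf nb) scale0r.
rewrite tblock_sum big1 // => b' _.
by rewrite tblock_tens mxE eq_sym (negPf na) scale0r.
Qed.

Lemma bform_blocks k (Z : 'M[C]_(d * k)) (v : 'cV[C]_(d * k)) :
  let w a : 'cV[C]_d := \col_i v (mxtens_index (i, a)) 0 in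
  bform Z v v = \sum_a \sum_b bform (tblock Z a b) (w a) (w b).
Proof.
move=> w.
have bE n (A : 'M[C]_n) (x y : 'cV[C]_n) :
    bform A x y = \sum_i \sum_j Num.conj (x i 0) * A i j * y j 0.
  rewrite /bform mxE exchange_big; apply: eq_bigr => j _.
  by rewrite mxE mulr_suml; apply: eq_bigr => i _; rewrite !mxE.
have reidx (F : 'I_(d * k) -> C) :
    \sum_p F p = \sum_a \sum_i F (mxtens_index (i, a)).
  rewrite pair_bigA /= (reindex (fun p : 'I_k * 'I_d => mxtens_index (p.2, p.1))) //=.
  exists (fun p => ((mxtens_unindex p).2, (mxtens_unindex p).1)) => p _.
    by rewrite mxtens_indexK; case: p.
  by rewrite -[RHS]mxtens_unindexK; case: (mxtens_unindex p).
rewrite bE reidx; apply: eq_bigr => a _.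
transitivity (\sum_i \sum_b \sum_j Num.conj (w a i 0) * tblock Z a b i j * w b j 0).
  apply: eq_bigr => i _; rewrite reidx; apply: eq_bigr => b _.
  by apply: eq_bigr => j _; rewrite !mxE.
by rewrite exchange_big; apply: eq_bigr => b _; rewrite bE.
Qed.

(** Slicing the test vector turns positivity on the tensor product into an inequality between forms
    on [C^d], free of tensor indices. *)
Lemma psd_blocks k (Z : 'M[C]_(d * k)) :
  psd Z <-> forall w : 'I_k -> 'cV[C]_d,
    0 <= \sum_a \sum_b bform (tblock Z a b) (w a) (w b).
Proof.
split=> [Zp w | Zp v]; last by rewrite bform_blocks.
pose v : 'cV[C]_(d * k) :=
  \col_p w (mxtens_unindex p).2 (mxtens_unindex p).1 0.
have := Zp v; rewrite bform_blocks.
suff e a : \col_i v (mxtens_index (i, a)) 0 = w a.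
  by under eq_bigr => a _ do under eq_bigr => b _ do rewrite !e.
by apply/matrixP => i j; rewrite !mxE mxtens_indexK ord1.
Qed.

(** Once [Y] is written as a Gram matrix, the block form becomes a sum of values of the form of
    [X]. *)
Lemma psd_tens k X (Y : 'M[C]_k) : psd X -> psd Y -> psd (X *t Y).
Proof.
move=> Xp /psd_gramP[B ->]; apply/psd_blocks => w.
pose u c := \sum_a B c a *: w a.
suff -> : \sum_a \sum_b bform (tblock (X *t (B^t* *m B)) a b) (w a) (w b) =
          \sum_c bform X (u c) (u c) by apply: sumr_ge0 => c _; exact: Xp.
transitivity (\sum_c \sum_a \sum_b Num.conj (B c a) * B c b * bform X (w a) (w b)).
  rewrite [RHS]exchange_big; apply: eq_bigr => a _; rewrite [RHS]exchange_big.
  apply: eq_bigr => b _; rewrite tblock_tens bformZl mxE mulr_suml.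
  by apply: eq_bigr => c _; rewrite !mxE.
apply: eq_bigr => c _; rewrite /bform /u adjmx_sum !mulmx_suml summxE.
apply: eq_bigr => a _; rewrite mulmx_sumr summxE; apply: eq_bigr => b _.
by rewrite -[RHS]/(bform X _ _) bformZ.
Qed.

Lemma tsep_psd k (Z : 'M[C]_(d * k)) : tsep Z -> psd Z.
Proof.
move=> [m [X [Y [XY ->]]]]; apply: psd_sum => j.
by apply: psd_tens; case: (XY j).
Qed.

Lemma tsep0 k : tsep (0 : 'M[C]_(d * k)).
Proof. by exists 0, (fun=> 0), (fun=> 0); split=> [[]//|]; rewrite big_ord0. Qed.

Lemma tsepD k (Z Z' : 'M[C]_(d * k)) :
  tsep Z -> tsep Z' -> tsep (Z + Z').
Proof.
move=> [m [X [Y [XY ->]]]] [m' [X' [Y' [XY' ->]]]].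
exists (m + m')%N, (fun j => match fintype.split j with inl i => X i | inr i => X' i end),
  (fun j => match fintype.split j with inl i => Y i | inr i => Y' i end); split=> [j|].
  by case: fintype.split => i; [apply: XY | apply: XY'].
rewrite big_split_ord; congr (_ + _); apply: eq_bigr => j _.
  by rewrite (unsplitK (inl j)).
by rewrite (unsplitK (inr j)).
Qed.

Lemma tsep_sum k I (r : seq I) (F : I -> 'M[C]_(d * k)) :
  (forall i, tsep (F i)) -> tsep (\sum_(i <- r) F i).
Proof.
move=> sF; elim/big_rec: _ => [|i Z _ sZ]; first exact: tsep0.
exact: tsepD.
Qed.

Lemma tsep_tens k X (Y : 'M[C]_k) : psd X -> psd Y -> tsep (X *t Y).
Proof.
by move=> Xp Yp; exists 1, (fun=> X), (fun=> Y); split=> //; rewrite big_ord1.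
Qed.

Lemma psd_conj_delta (U : Md) j : psd (U *m delta_mx j j *m U^t*).
Proof.
rewrite -(mul_delta_mx j j j) mulmxA -mulmxA.
rewrite -{1}[U]trmxCK -[X in _ *m X *m _]adjmx_delta -adjmxM; exact: psd_gram.
Qed.

(** Measuring and preparing breaks entanglement: each pair [(l, j)] contributes the prepared
    projection tensored with [Y l j], the compression of [Z] by the measured vector [V l e_j] in the
    first factor. *)
Lemma mixed_tdeph_sep m (p : 'I_m -> C) (U V : 'I_m -> Md) f k (Z : 'M[C]_(d * k)) :
  (forall l, 0 <= p l) -> (forall X, f X = \sum_l p l *: tdeph (U l) (V l) X) ->
  psd Z -> tsep (tmap f Z).
Proof.
move=> p0 fE Zp.
pose Y l j : 'M[C]_k := \matrix_(a, b) ((V l)^t* *m tblock Z a b *m V l) j j.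
pose F l j := U l *m delta_mx j j *m (U l)^t*.
have -> : tmap f Z = \sum_l \sum_j (p l *: F l j) *t Y l j.
  apply: tblockK => a b; rewrite tblock_id fE tblock_sum.
  apply: eq_bigr => l _; rewrite scaler_sumr tblock_sum.
  by apply: eq_bigr => j _; rewrite tblock_tens [Y _ _ _ _]mxE !scalerA mulrC.
apply: tsep_sum => l; apply: tsep_sum => j; apply: tsep_tens.
  by apply: psdZ; [exact: p0 | exact: psd_conj_delta].
(* The form of [Y l j] at [v] is the form of [Z] at the product vector of [V l e_j] and [v]. *)
move=> v; have /psd_blocks/(_ (fun a => v a 0 *: (V l *m delta_mx j 0))) := Zp.
congr (0 <= _); rewrite [RHS]mxE exchange_big; apply: eq_bigr => b _.
rewrite [in RHS]mxE mulr_suml; apply: eq_bigr => a _.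
rewrite bformZ -bform_mulmx bform_delta !mxE.
by rewrite mulrAC.
Qed.

(** Transposing the first factor before [f] amounts to transposing all of [Z] before [f] and the
    second factor afterwards; a separable matrix stays positive under this partial transposition. *)
Lemma tsep_transpose f k (Z : 'M[C]_(d * k)) :
  tsep (tmap f Z^T) -> psd (tmap (f \o trmx) Z).
Proof.
move=> [m [X [Y [XY eZ]]]].
suff -> : tmap (f \o trmx) Z = \sum_j X j *t (Y j)^T.
  by apply: psd_sum => j; have [Xp Yp] := XY j; apply/psd_tens/psd_tr.
apply: tblockK => a b; rewrite tblock_id /=.
have -> : (tblock Z a b)^T = tblock Z^T b a by apply/matrixP => i j; rewrite !mxE.
rewrite -tblock_id eZ !tblock_sum; apply: eq_bigr => j _.
by rewrite !tblock_tens mxE.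
Qed.

End Blocks.

Section Channels.
Variables (R : realType) (d : nat).
Local Notation Md := 'M[R[i]]_d.
Implicit Type phi : {linear Md -> Md}.

Lemma twisted_dephasingE (U V X : Md) : twisted_dephasing U V X = tdeph U V X.
Proof.
rewrite /twisted_dephasing /Ad /dephasing trmxCK mulmx_sumr mulmx_suml.
by apply: eq_bigr => j _; rewrite -scalemxAr -scalemxAl.
Qed.

Lemma mixed_twisted_dephasing_EB phi :
  mixed_twisted_dephasing phi -> entanglement_breaking phi.
Proof.
move=> [m [p [U [V [p0 _ _ phiE]]]]] k Z k0.
apply: (@mixed_tdeph_sep _ _ m (fun j => (p j)%:C) U V) => [j|X]; first by rewrite ler0c.
by rewrite phiE; apply: eq_bigr => j _; rewrite twisted_dephasingE.
Qed.

Lemma EB_PPT phi : entanglement_breaking phi -> PPT phi.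
Proof.
move=> EB; split=> k k0 Z Zp; first exact/tsep_psd/EB.
exact/tsep_transpose/EB/psd_tr.
Qed.

Lemma PPT_copositive2 phi : PPT phi -> copositive 2 phi.
Proof. by case=> _; apply. Qed.

End Channels.

(** * The Schwarz inequality and multiplicative domains *)

Section HilbertSchmidt.
Variables (C : numClosedFieldType) (d : nat).
Implicit Types X Y : 'M[C]_d.

Definition hs X Y : C := \tr (X^t* *m Y).

Lemma hsE X Y : hs X Y = \sum_i \sum_j Num.conj (X i j) * Y i j.
Proof.
rewrite /hs exchange_big; apply: eq_bigr => j _; rewrite mxE.
by apply: eq_bigr => i _; rewrite !mxE.
Qed.

Lemma hsC X Y : Num.conj (hs X Y) = hs Y X.
Proof.
rewrite !hsE rmorph_sum; apply: eq_bigr => i _; rewrite rmorph_sum.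
by apply: eq_bigr => j _; rewrite rmorphM /= conjCK mulrC.
Qed.

Lemma hsDl X Y Z : hs (X + Y) Z = hs X Z + hs Y Z.
Proof. by rewrite /hs adjmxD mulmxDl raddfD. Qed.

Lemma hsDr X Y Z : hs X (Y + Z) = hs X Y + hs X Z.
Proof. by rewrite /hs mulmxDr raddfD. Qed.

Lemma hsZr c X Y : hs X (c *: Y) = c * hs X Y.
Proof. by rewrite /hs -scalemxAr mxtraceZ. Qed.

Lemma hsZl c X Y : hs (c *: X) Y = Num.conj c * hs X Y.
Proof. by rewrite /hs adjmxZ -scalemxAl mxtraceZ. Qed.

Lemma hs_ge0 X : 0 <= hs X X.
Proof.
rewrite hsE; apply: sumr_ge0 => i _; apply: sumr_ge0 => j _.
by rewrite mulrC mul_conjC_ge0.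
Qed.

Lemma hs_eq0 X : hs X X = 0 -> X = 0.
Proof.
have p0 i j : 0 <= Num.conj (X i j) * X i j by rewrite mulrC mul_conjC_ge0.
rewrite hsE => /eqP; rewrite psumr_eq0; last by move=> i _; exact: sumr_ge0.
move=> /allP X0; apply/matrixP => i j; rewrite mxE.
have := X0 i (mem_index_enum i) => /=.
rewrite psumr_eq0 => [/allP/(_ j (mem_index_enum j))/=|//].
by rewrite mulrC mul_conjC_eq0 => /eqP.
Qed.

Lemma hs_adj X : hs (X^t*) (X^t*) = hs X X.
Proof. by rewrite /hs trmxCK mxtrace_mulC. Qed.

Lemma trace_delta_mul i j X : \tr (delta_mx i j *m X) = X j i.
Proof.
rewrite -(mul_delta_mx (0 : 'I_1)) -mulmxA mxtrace_mulC -rowE -colE trace_mx11.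
by rewrite !mxE.
Qed.

Lemma psd_trace_eq0 (A : 'M[C]_d) : psd A -> \tr A = 0 -> A = 0.
Proof. by move=> /psd_gramP[B ->] /hs_eq0 ->; rewrite mulmx0. Qed.

End HilbertSchmidt.

Section Schwarz.
Variables (C : numClosedFieldType) (d : nat).
Local Notation Md := 'M[C]_d.
Variable f : {linear Md -> Md}.
Hypothesis f2 : forall Z : 'M[C]_(d * 2), psd Z -> psd (tmap f Z).
Implicit Types (X Y : Md) (v : 'cV[C]_d).

(** The matrix of blocks [(A a)^t* *m A b] is a Gram matrix, and 2-positivity lets [f] act on its
    blocks. *)
Lemma two_positive_blocks (A : 'I_2 -> Md) : exists2 Z : 'M[C]_(d * 2),
  psd Z & forall a b, tblock Z a b = f ((A a)^t* *m A b).
Proof.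
pose Z : 'M[C]_(d * 2) := \matrix_(p, q) ((A (mxtens_unindex p).2)^t* *m
  A (mxtens_unindex q).2) (mxtens_unindex p).1 (mxtens_unindex q).1.
have eZ a b : tblock Z a b = (A a)^t* *m A b.
  by apply/matrixP => i j; rewrite [LHS]mxE [LHS]mxE !mxtens_indexK.
exists (tmap f Z); last by move=> a b; rewrite tblock_id eZ.
apply/f2/psd_blocks => w.
suff -> : \sum_a \sum_b bform (tblock Z a b) (w a) (w b) =
    bform 1%:M (\sum_a A a *m w a) (\sum_a A a *m w a) by exact: psd1.
rewrite /bform adjmx_sum !mulmx_suml summxE; apply: eq_bigr => a _.
rewrite mulmx_sumr summxE; apply: eq_bigr => b _.
by rewrite eZ /bform mulmx1 adjmxM !mulmxA.
Qed.

(** With [A 0 = X] and [A 1 = 1], the two off-diagonal blocks are mutually adjoint because a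
    positive matrix is Hermitian. *)
Lemma two_positive_adj X : f (X^t*) = (f X)^t*.
Proof.
have [Z Zp eZ] := two_positive_blocks (fun a => if a == 0 then X else 1%:M).
have := eZ 0 1; have := eZ 1 0; rewrite /= adjmx1 mul1mx mulmx1 => <- <-.
by apply/matrixP => i j; rewrite -{1}(psd_herm Zp) !mxE.
Qed.

Hypothesis f1 : f 1%:M = 1%:M.

Definition schwarz_defect X Y := f (X^t* *m Y) - (f X)^t* *m f Y.

(** A Schur complement: the block matrix built from [X] and the identity is tested on the pair [v],
    [- f X v]. *)
Lemma schwarz_defect_psd X : psd (schwarz_defect X X).
Proof.
move=> v; have [Z Zp eZ] := two_positive_blocks (fun a => if a == 0 then X else 1%:M).
have /psd_blocks/(_ (fun a => if a == 0 then v else - (f X *m v))) := Zp.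
rewrite !big_ord_recl !big_ord0 /= !addr0 !eZ /= adjmx1 !mul1mx mulmx1 f1 two_positive_adj.
congr (0 <= _); rewrite /schwarz_defect bformDl bformNl -addrA; congr (_ + _).
rewrite /bform !adjmxN !(mulmxN, mulNmx) opprK mulmx1 adjmxM !mulmxA !mxE.
by rewrite addNr addr0.
Qed.

Lemma schwarz_defect_adj X Y : (schwarz_defect X Y)^t* = schwarz_defect Y X.
Proof.
by rewrite /schwarz_defect adjmxB adjmxM trmxCK -(two_positive_adj (X^t* *m Y)) adjmxM trmxCK.
Qed.

Lemma schwarz_defectDr X Y Z :
  schwarz_defect X (Y + Z) = schwarz_defect X Y + schwarz_defect X Z.
Proof. by rewrite /schwarz_defect mulmxDr !(linearD f) mulmxDr opprD addrACA. Qed.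

Lemma schwarz_defectZr c X Y : schwarz_defect X (c *: Y) = c *: schwarz_defect X Y.
Proof. by rewrite /schwarz_defect -scalemxAr ![f (_ *: _)]linearZ /= -scalemxAr scalerBr. Qed.

(** Cauchy-Schwarz for the positive matrix-valued form [schwarz_defect]: a vector of zero length is
    orthogonal to everything. This gives the multiplicative domain. *)
Lemma schwarz_defect_eq0 X Y : schwarz_defect X X = 0 -> schwarz_defect Y X = 0.
Proof.
move=> DX0; apply: bform_eq0 => v; set b := bform _ v v.
pose e := bform (schwarz_defect Y Y) v v.
have e0 : 0 <= e by exact: schwarz_defect_psd.
have q c : 0 <= Num.conj c * b + c * Num.conj b + Num.conj c * c * e.
  have := schwarz_defect_psd (X + c *: Y) v.
  rewrite schwarz_defectDr schwarz_defectZr bformDl bformZl.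
  rewrite -(schwarz_defect_adj X) -(schwarz_defect_adj Y) -!bform_conj.
  rewrite !schwarz_defectDr !schwarz_defectZr DX0 !(bformDl _ (_ *: _)) !bformZl bform0 add0r.
  rewrite !rmorphD !rmorphM /= -/b -/e (CrealP (ger0_real e0)).
  rewrite -[bform (schwarz_defect X Y) v v]conjCK bform_conj schwarz_defect_adj.
  by rewrite conjCK -/b mulrDr addrA mulrA [c * _]mulrC [c * Num.conj c]mulrC.
have e1 : 0 < e + 1 by rewrite ltr_wpDl.
have tr : Num.conj (e + 1)^-1 = (e + 1)^-1.
  by apply/CrealP/ger0_real; rewrite invr_ge0 ltW.
(* With [c = - t b] the quadratic expression is [- t (2 - t e) |b|^2]. Dividing by [e + 1] instead
   of [e] covers [e = 0] and keeps [t e < 1]. *)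
have := q (- ((e + 1)^-1 * b)); set t := (e + 1)^-1.
rewrite rmorphN rmorphM /= tr -/t.
have -> : - (t * Num.conj b) * b + - (t * b) * Num.conj b +
  - (t * Num.conj b) * - (t * b) * e = - (t * (2 - t * e) * (b * Num.conj b)) by ring.
rewrite oppr_ge0 => le0.
have t0 : 0 < t by rewrite invr_gt0.
have te : t * e < 1 by rewrite mulrC ltr_pdivrMr // mul1r ltrDl.
have p : 0 < t * (2 - t * e).
  by rewrite mulr_gt0 // subr_gt0 (lt_trans te) // ltr1n.
rewrite pmulr_rle0 // in le0; apply/eqP; rewrite -mul_conjC_eq0 eq_le le0.
by rewrite mul_conjC_ge0.
Qed.

Hypothesis ftr : forall X, \tr (f X) = \tr X.

Lemma hs_contraction X : hs (f X) (f X) <= hs X X.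
Proof.
have := psd_trace_ge0 (schwarz_defect_psd X).
by rewrite /schwarz_defect raddfB /= ftr subr_ge0.
Qed.

(** Equal norms say that the positive matrix [schwarz_defect X X] has trace zero, so it vanishes and
    [schwarz_defect_eq0] applies. *)
Lemma hs_isometryMr X Y : hs (f X) (f X) = hs X X -> f (Y *m X) = f Y *m f X.
Proof.
move=> iX; have D0 : schwarz_defect X X = 0.
  apply: psd_trace_eq0; first exact: schwarz_defect_psd.
  by rewrite /schwarz_defect raddfB /= ftr -[X in X - _]iX subrr.
have /eqP := schwarz_defect_eq0 (Y^t*) D0; rewrite subr_eq0 => /eqP.
by rewrite two_positive_adj !trmxCK.
Qed.

Lemma hs_isometryMl X Y : hs (f X) (f X) = hs X X -> f (X *m Y) = f X *m f Y.
Proof.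
move=> iX; rewrite -[LHS]trmxCK -two_positive_adj adjmxM hs_isometryMr.
  by rewrite adjmxM !two_positive_adj !trmxCK.
by rewrite two_positive_adj !hs_adj.
Qed.

End Schwarz.

(** * The Hilbert-Schmidt norm with real values *)

Section Norm.
Variables (R : realType) (C : numClosedFieldType) (rc : {rmorphism R -> C}).
Variable nc : C -> R.
Hypothesis rc_le : forall x y, (rc x <= rc y) = (x <= y).
Hypothesis rc_nc : forall z, rc (nc z) = `|z|.

Lemma rc_inj : injective rc.
Proof. by move=> x y e; apply/eqP; rewrite eq_le -!rc_le e lexx. Qed.

Lemma rc_ge0 x : (0 <= rc x) = (0 <= x).
Proof. by rewrite -(rmorph0 rc) rc_le. Qed.

Lemma nc_ge0 z : 0 <= nc z.
Proof. by rewrite -rc_ge0 rc_nc. Qed.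

Lemma ncM z w : nc (z * w) = nc z * nc w.
Proof. by apply: rc_inj; rewrite rmorphM /= !rc_nc normrM. Qed.

Lemma nc_rc x : 0 <= x -> nc (rc x) = x.
Proof. by move=> x0; apply: rc_inj; rewrite rc_nc ger0_norm // rc_ge0. Qed.

Lemma nc1 : nc 1 = 1.
Proof. by rewrite -(rmorph1 rc) nc_rc. Qed.

Lemma nc_eq0 z : (nc z == 0) = (z == 0).
Proof. by rewrite -(inj_eq rc_inj) rc_nc rmorph0 normr_eq0. Qed.

Lemma ncD z w : nc (z + w) <= nc z + nc w.
Proof. by rewrite -rc_le rmorphD /= !rc_nc ler_normD. Qed.

Variable d : nat.
Local Notation Md := 'M[C]_d.
Implicit Types X Y Z : Md.

(** Applying [nc] to a square root that is already nonnegative moves the norm from [C] into the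
    ordered field [R], where the estimates are made. *)
Definition hsn X : R := nc (sqrtC (hs X X)).

Lemma rc_hsn X : rc (hsn X) = sqrtC (hs X X).
Proof. by rewrite rc_nc ger0_norm // sqrtC_ge0 hs_ge0. Qed.

Lemma hsn_ge0 X : 0 <= hsn X.
Proof. exact: nc_ge0. Qed.

Lemma hsn_sqr X : rc (hsn X ^+ 2) = hs X X.
Proof. by rewrite rmorphXn /= rc_hsn sqrtCK. Qed.

Lemma hsn_le X Y : (hsn X <= hsn Y) = (hs X X <= hs Y Y).
Proof. by rewrite -!hsn_sqr rc_le ler_sqr ?nnegrE ?hsn_ge0. Qed.

Lemma hsn_eq X Y : hsn X = hsn Y <-> hs X X = hs Y Y.
Proof. by rewrite -!hsn_sqr; split=> [-> //|e]; rewrite /hsn -!hsn_sqr e. Qed.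

Lemma hsn_eq0 X : hsn X = 0 -> X = 0.
Proof. by move=> e; apply: hs_eq0; rewrite -hsn_sqr e expr0n rmorph0. Qed.

Lemma hsn0 : hsn 0 = 0.
Proof. by rewrite /hsn /hs mulmx0 mxtrace0 sqrtC0 -(rmorph0 rc) nc_rc. Qed.

Lemma hsnZ c X : hsn (c *: X) = nc c * hsn X.
Proof.
apply: rc_inj; rewrite rmorphM /= !rc_hsn rc_nc hsZl hsZr mulrA [_ * c]mulrC.
by rewrite -normCK rootCMl ?exprn_ge0 // exprCK.
Qed.

Lemma hsnN X : hsn (- X) = hsn X.
Proof.
by rewrite -scaleN1r hsnZ -[RHS]mul1r; congr (_ * _); apply: rc_inj; rewrite rc_nc normrN1 rmorph1.
Qed.

Lemma hsn_adj X : hsn (X^t*) = hsn X.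
Proof. by rewrite /hsn hs_adj. Qed.

(** Flattening identifies the Hilbert-Schmidt product with the standard one, from which the triangle
    and Cauchy-Schwarz inequalities are inherited. *)
Lemma hs_dotmx X Y : dotmx (mxvec X) (mxvec Y) = hs Y X.
Proof.
rewrite dotmxE mxE (reindex _ (curry_mxvec_bij _ _)) hsE pair_bigA /=.
by apply: eq_bigr => -[i j] _; rewrite /= !mxE !mxvecE mulrC.
Qed.

Lemma hsnD X Y : hsn (X + Y) <= hsn X + hsn Y.
Proof.
rewrite -rc_le rmorphD /= !rc_hsn -!hs_dotmx linearD.
by have [] := triangle_lerif (@dotmx C _) (mxvec X) (mxvec Y).
Qed.

Lemma hsn_hs X Y : nc (hs X Y) <= hsn X * hsn Y.
Proof.
rewrite -ler_sqr ?nnegrE ?nc_ge0 ?mulr_ge0 ?hsn_ge0 //.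
rewrite -rc_le exprMn [leLHS]rmorphXn /= rc_nc rmorphM /= !hsn_sqr mulrC -!hs_dotmx.
by have [] := CauchySchwarz (@dotmx C _) (mxvec Y) (mxvec X).
Qed.

Lemma hsn_entry X i j : nc (X i j) <= hsn X.
Proof.
rewrite -ler_sqr ?nnegrE ?nc_ge0 ?hsn_ge0 // -rc_le hsn_sqr rmorphXn /= rc_nc.
rewrite hsE (bigD1 i) //= (bigD1 j) //= normCK mulrC -addrA lerDl addr_ge0 //.
  by apply: sumr_ge0 => k _; rewrite mulrC mul_conjC_ge0.
by apply: sumr_ge0 => k _; apply: sumr_ge0 => l _; rewrite mulrC mul_conjC_ge0.
Qed.

Lemma hsn_sum I (r : seq I) (F : I -> Md) : hsn (\sum_(i <- r) F i) <= \sum_(i <- r) hsn (F i).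
Proof.
elim/big_rec2: _ => [|i x X _ le]; first by rewrite hsn0.
by apply: le_trans (hsnD _ _) _; rewrite lerD2l.
Qed.

Lemma hsn_le_entries X : hsn X <= \sum_(p : 'I_d * 'I_d) nc (X p.1 p.2).
Proof.
rewrite {1}[X]matrix_sum_delta pair_bigA /=; apply: le_trans (hsn_sum _ _) _.
apply: ler_sum => p _; rewrite hsnZ /hsn /hs adjmx_delta mul_delta_mx.
suff -> : \tr (delta_mx p.2 p.2 : Md) = 1 by rewrite sqrtC1 nc1 mulr1.
rewrite /mxtrace (bigD1 p.2) //= mxE !eqxx big1 ?addr0 // => k kp.
by rewrite mxE (negPf kp).
Qed.

Lemma nc_trace X : nc (\tr X) <= d%:R * hsn X.
Proof.
have nc0 : nc 0 = 0 by apply/eqP; rewrite nc_eq0.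
have -> : d%:R * hsn X = \sum_(i < d) hsn X by rewrite sumr_const card_ord mulr_natl.
rewrite /mxtrace; elim/big_rec2: _ => [|i x z _ le]; first by rewrite nc0.
by apply: le_trans (ncD _ _) _; rewrite lerD // hsn_entry.
Qed.

Lemma hsn_dist X Y : hsn X <= hsn Y + hsn (X - Y).
Proof. by apply: le_trans (hsnD _ _); rewrite addrC subrK. Qed.

Lemma hsnBC X Y : hsn (X - Y) = hsn (Y - X).
Proof. by rewrite -hsnN opprB. Qed.

End Norm.

(** * Annihilating products of shifts and eigenvectors *)

Section Annihilator.
Variables (C : numClosedFieldType) (d : nat).
Local Notation Md := 'M[C]_d.
Variable f : {linear Md -> Md}.

Definition shift (Z : Md) (mu : C) : Md := f Z - mu *: Z.

(** Cayley-Hamilton with the characteristic polynomial split into linear factors: [s] lists its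
    roots with multiplicity. *)
Lemma exists_annihilator : exists2 s : seq C,
  size s = (d * d)%N & forall X, foldl shift X s = 0.
Proof.
have [d0|d0] := posnP d.
  exists [::] => [|X]; first by rewrite d0.
  by apply/matrixP => i; have := ltn_ord i; rewrite [X in (_ < X)%N]d0.
have dd0 : (d * d = (d * d).-1.+1)%N by rewrite prednK // muln_gt0 d0.
(* The cast puts the size [d * d] in successor form, in which a polynomial is evaluated at the
   matrix. *)
pose A := castmx (dd0, dd0) (lin_mx f).
have [r er] := closed_field_poly_normal (char_poly A).
have lc : lead_coef (char_poly A) = 1 by apply/eqP; exact: char_poly_monic.
rewrite lc scale1r in er; exists r => [|X].
  by have := size_char_poly A; rewrite er size_prod_XsubC prednK ?muln_gt0 ?d0 // => -[].
apply: (can_inj mxvecK); rewrite linear0.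
have vA (Y : Md) :
    castmx (erefl, dd0) (mxvec Y) *m A = castmx (erefl, dd0) (mxvec (f Y)).
  rewrite /A; move: (dd0); move: (d * d).-1.+1 => m.
  by case: m /; rewrite !castmx_id mul_vec_lin.
have step (s : seq C) Y : castmx (erefl, dd0) (mxvec Y) *m
    horner_mx A (\prod_(z <- s) ('X - z%:P)) = castmx (erefl, dd0) (mxvec (foldl shift Y s)).
  elim: s Y => [|z s IH] Y; first by rewrite big_nil rmorph1 mulmx1.
  rewrite big_cons rmorphM rmorphB /= horner_mx_X horner_mx_C -IH.
  rewrite -mulmxE mulmxA; congr (_ *m _); rewrite mulmxBr vA mul_mx_scalar /shift.
  have -> : mxvec (f Y - z *: Y) = mxvec (f Y) - z *: mxvec Y by rewrite linearB linearZ.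
  move: (mxvec _) (mxvec _) => u v.
  by apply/matrixP => i j; rewrite !(castmxE, mxE).
have := step r X; rewrite -er Cayley_Hamilton mulmx0.
move=> e; apply/matrixP => i j.
by have /matrixP/(_ i (cast_ord dd0 j)) := e;
  rewrite castmxE !mxE /= cast_ord_id cast_ordK => <-.
Qed.

Lemma shift_foldl s Z mu : foldl shift (shift Z mu) s = shift (foldl shift Z s) mu.
Proof.
elim: s Z => //= nu s IH Z; rewrite -IH; congr foldl.
have fB c : f (f Z - c *: Z) = f (f Z) - c *: f Z by rewrite linearB linearZ.
by rewrite /shift !fB; apply/matrixP => i j; rewrite !mxE; ring.
Qed.

(** The factors of the annihilator are applied to [X] one at a time; the last nonzero result is an
    eigenvector, and every intermediate result satisfies [P]. *)
Lemma stable_eigenvector (P : Md -> Prop) X :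
  (forall Z mu, P Z -> P (shift Z mu)) -> P X -> X != 0 ->
  exists mu Y, [/\ P Y, Y != 0 & f Y = mu *: Y].
Proof.
move=> stP; have [s _ /(_ X)] := exists_annihilator; elim: s X => [|mu s IH] X /=.
  by move=> ->; rewrite eqxx.
have [/eqP e _ PX X0|Y0 e PX X0] := eqVneq (shift X mu) 0.
  by exists mu, X; split=> //; apply/eqP; rewrite -subr_eq0.
exact: (IH _ e (stP _ _ PX) Y0).
Qed.

(** On an eigenvector each shift acts as the scalar [lam - mu], so the product can vanish only if
    some factor does. *)
Lemma eigenvalue_annihilator s lam Y :
  (forall X, foldl shift X s = 0) -> f Y = lam *: Y -> Y != 0 -> lam \in s.
Proof.
move=> /(_ Y) e0 eY Y0; apply: contraT => ns; move: e0 => /eqP; apply: contraLR => _.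
elim: s Y eY Y0 ns => [|mu s IH] Y eY Y0 //=; rewrite inE negb_or => /andP[lm ls].
have -> : shift Y mu = (lam - mu) *: Y by rewrite /shift eY scalerBl.
apply: IH => //; rewrite ?linearZ /= ?eY 1?scalerA 1?mulrC -?scalerA //.
by rewrite scaler_eq0 subr_eq0 negb_or lm.
Qed.

End Annihilator.

(** * Decay under a perturbed linear recurrence *)

Section Decay.
Variable R : realType.

(** By monotonicity one value at most [e] is enough. If all values exceeded [e], each late step
    would lower [a] by a fixed amount, and [a] would become negative. *)
Lemma decay_recurrence (a b : nat -> R) (q : R) : q < 1 ->
  (forall n, 0 <= a n) -> (forall n, a n.+1 <= a n) ->
  (forall n, a n.+1 <= q * a n + b n) ->
  (forall e, 0 < e -> exists n0, forall n, (n0 <= n)%N -> b n <= e) ->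
  forall e, 0 < e -> exists n0, forall n, (n0 <= n)%N -> a n <= e.
Proof.
move=> q1 a0 amono arec bdecay e e0.
suff [n0 an0] : exists n0, a n0 <= e.
  exists n0; elim=> [|n IH]; first by rewrite leqn0 => /eqP <-.
  rewrite leq_eqVlt => /orP[/eqP <- //|]; rewrite ltnS => /IH.
  by apply: le_trans.
apply: contrapT => noa; have ae n : e < a n.
  by rewrite ltNge; apply/negP => le; apply: noa; exists n.
(* Half of the guaranteed loss [(1 - q) * e] absorbs [b n]; the other half is the net decrease per
   step. *)
pose c := (1 - q) * e / 2.
have c0 : 0 < c by rewrite divr_gt0 // mulr_gt0 // subr_gt0.
have [n0 bn0] := bdecay c c0.
have lin k : a (n0 + k)%N <= a n0 - k%:R * c.
  elim: k => [|k IH]; first by rewrite addn0 mul0r subr0.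
  rewrite addnS; apply: le_trans (arec _) _.
  have le1 := bn0 (n0 + k)%N (leq_addr _ _).
  have le2 : (1 - q) * e <= (1 - q) * a (n0 + k)%N.
    by apply: ler_wpM2l; [rewrite subr_ge0 ltW | exact: ltW (ae _)].
  rewrite -natr1 mulrDl mul1r.
  have ce : (1 - q) * e = 2 * c by rewrite /c; field.
  have qa : q * a (n0 + k)%N = a (n0 + k)%N - (1 - q) * a (n0 + k)%N by ring.
  rewrite ce in le2; rewrite qa; move: IH le1 le2; set x := (1 - q) * _; set y := _ * c.
  lra.
have := lin (Num.truncn (a n0 / c)).+1; apply/negP; rewrite -ltNge.
apply: lt_le_trans (a0 _); rewrite subr_lt0 -ltr_pdivrMr //.
exact: truncnS_gt.
Qed.

End Decay.

(** * Contraction semigroups of two-positive maps *)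

Section Semigroups.
(* C plays the role of R[i], with rc the embedding of R and nc the modulus. *)
Variables (R : realType) (C : numClosedFieldType) (rc : {rmorphism R -> C}).
Variable nc : C -> R.
Hypothesis rc_le : forall x y, (rc x <= rc y) = (x <= y).
Hypothesis rc_nc : forall z, rc (nc z) = `|z|.
Variable d : nat.
Local Notation Md := 'M[C]_d.
Local Notation N := (@hsn R C nc d).
Variables (tau : R -> {linear Md -> Md}) (L : {linear Md -> Md}).
Hypothesis tau0 : forall X, tau 0 X = X.
Hypothesis tauD : forall (s t : R) X, 0 <= s -> 0 <= t -> tau (s + t) X = tau s (tau t X).
Hypothesis tau2 : forall t : R, 0 <= t -> forall Z : 'M[C]_(d * 2), psd Z -> psd (tmap (tau t) Z).
Hypothesis tau1 : forall t : R, 0 <= t -> tau t 1%:M = 1%:M.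
Hypothesis tau_tr : forall (t : R) X, 0 <= t -> \tr (tau t X) = \tr X.
Hypothesis tauL : forall X (e : R), 0 < e -> exists2 delta : R, 0 < delta &
  forall t : R, 0 < t -> t < delta -> N (tau t X - X - rc t *: L X) <= e * t.
Implicit Types (X Y Z : Md).

Let N_ge0 := @hsn_ge0 R C rc nc rc_le rc_nc d.
Let NZ := @hsnZ R C rc nc rc_le rc_nc d.
Let ND := @hsnD R C rc nc rc_le rc_nc d.
Let NN := @hsnN R C rc nc rc_le rc_nc d.
Let N0 := @hsn0 R C rc nc rc_le rc_nc d.
Let N_eq0 := @hsn_eq0 R C rc nc rc_nc d.

Lemma tau_contraction t X : 0 <= t -> N (tau t X) <= N X.
Proof.
move=> t0; rewrite (hsn_le rc_le rc_nc).
by apply: hs_contraction; [exact: tau2 | exact: tau1 | move=> Y; exact: tau_tr].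
Qed.

Lemma tau_mulMr t X Y : 0 <= t -> N (tau t X) = N X -> tau t (Y *m X) = tau t Y *m tau t X.
Proof.
move=> t0 /(hsn_eq rc_nc) iX.
by apply: hs_isometryMr => //; [exact: tau2 | exact: tau1 | move=> Z; exact: tau_tr].
Qed.

Lemma tau_mulMl t X Y : 0 <= t -> N (tau t X) = N X -> tau t (X *m Y) = tau t X *m tau t Y.
Proof.
move=> t0 /(hsn_eq rc_nc) iX.
by apply: hs_isometryMl => //; [exact: tau2 | exact: tau1 | move=> Z; exact: tau_tr].
Qed.

Lemma tau_adj t X : 0 <= t -> tau t (X^t*) = (tau t X)^t*.
Proof. by move=> t0; apply: two_positive_adj; exact: tau2. Qed.

Lemma tauS n h X : 0 <= h -> tau (n.+1%:R * h) X = tau h (tau (n%:R * h) X).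
Proof. by move=> h0; rewrite -tauD ?mulr_ge0 // -nat1r mulrDl mul1r. Qed.

Lemma eps_le0 (x : R) : (forall e, 0 < e -> x <= e) -> x <= 0.
Proof. by move=> xe; apply/ler_addgt0Pr => e /xe; rewrite add0r. Qed.

Lemma N_eps_eq0 X : (forall e, 0 < e -> N X <= e) -> X = 0.
Proof.
by move=> /eps_le0 le; apply: N_eq0; apply/eqP; rewrite eq_le le N_ge0.
Qed.

(* Telescoping over n steps of length t / n: contractivity makes the error at
   most n times the one-step error, which is o(t / n). *)
Lemma generator_eigenvector (E : R -> C) mu X :
  (forall s t, 0 <= s -> 0 <= t -> E (s + t) = E s * E t) ->
  (forall t, nc (E t) = 1) ->
  (forall e, 0 < e -> exists2 delta : R, 0 < delta &
     forall t : R, 0 < t -> t < delta -> nc (E t - 1 - rc t * mu) <= e * t) ->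
  L X = mu *: X -> forall t, 0 < t -> tau t X = E t *: X.
Proof.
move=> ED E1 Eder LX t t0; apply/eqP; rewrite -subr_eq0; apply/eqP.
apply: N_eps_eq0 => e e0.
(* One step costs [e1 * h] for [tau] and [e1 * h * N X] for [E]; this choice makes [n] steps of
   length [h = t / n] cost exactly [e]. *)
pose e1 := e / (t * (1 + N X)).
have p1 : 0 < t * (1 + N X) by rewrite mulr_gt0 // ltr_pwDl.
have e10 : 0 < e1 by rewrite divr_gt0.
have [d1 d10 H1] := tauL X e10; have [d2 d20 H2] := Eder e1 e10.
pose n := (Num.truncn (t / Num.min d1 d2)).+1; pose h := t / n%:R.
have m0 : 0 < Num.min d1 d2 by rewrite lt_min d10.
have n0 : 0 < n%:R :> R by rewrite ltr0n.
have h0 : 0 < h by rewrite divr_gt0.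
have h0' := ltW h0.
have hm : h < Num.min d1 d2.
  by rewrite /h ltr_pdivrMr // mulrC -ltr_pdivrMr // truncnS_gt.
have step : N (tau h X - E h *: X) <= e1 * h * (1 + N X).
  have -> : tau h X - E h *: X =
      (tau h X - X - rc h *: L X) - (E h - 1 - rc h * mu) *: X.
    by rewrite LX; apply/matrixP => i j; rewrite !mxE; ring.
  apply: le_trans (ND _ _) _; rewrite NN NZ mulrDr mulr1 lerD //.
    by apply: H1 => //; rewrite (lt_le_trans hm) // ge_min lexx.
  rewrite ler_wpM2r ?N_ge0 //; apply: H2 => //.
  by rewrite (lt_le_trans hm) // ge_min lexx orbT.
have tel k : N (tau (k.+1%:R * h) X - E (k.+1%:R * h) *: X) <=
    k.+1%:R * N (tau h X - E h *: X).
  elim: k => [|k IH]; first by rewrite !mul1r.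
  have kh : 0 <= k.+1%:R * h by rewrite mulr_ge0.
  rewrite tauS // -[k.+2]add1n natrD !mulrDl !mul1r ED //.
  set x := k.+1%:R * h in kh IH *.
  have -> : tau h (tau x X) - (E h * E x) *: X =
      E x *: (tau h X - E h *: X) + tau h (tau x X - E x *: X).
    have -> : tau h (tau x X - E x *: X) = tau h (tau x X) - E x *: tau h X.
      by rewrite linearB linearZ.
    by apply/matrixP => i j; rewrite !mxE; ring.
  apply: le_trans (ND _ _) _; rewrite lerD // ?NZ ?E1 ?mul1r //.
  exact: le_trans (tau_contraction _ h0') IH.
have := tel n.-1; rewrite -/n /h mulrC divfK ?gt_eqF // => /le_trans; apply.
apply: le_trans (ler_wpM2l (ltW n0) step) _.
rewrite /h /e1 le_eqVlt; apply/orP; left; apply/eqP.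
by field; rewrite ?(gt_eqF n0) ?(gt_eqF t0) ?gt_eqF // ltr_pwDl.
Qed.

Lemma fixed_generator X : (forall t, 0 <= t -> tau t X = X) -> L X = 0.
Proof.
move=> fX; apply: N_eps_eq0 => e e0; have [dl dl0 H] := tauL X e0.
have h0 : 0 < dl / 2 by rewrite divr_gt0.
have h0' := ltW h0.
have hdl : dl / 2 < dl by rewrite ltr_pdivrMr // ltr_pMr // ltr1n.
have := H _ h0 hdl; rewrite fX // subrr sub0r NN NZ (nc_rc rc_le rc_nc) //.
by rewrite [_ * N _]mulrC ler_pM2r.
Qed.

(** For small [t] the map [tau t] is within one half of the identity in operator norm; only the
    finitely many matrix units have to be controlled. *)
Lemma tau_small_injective : exists2 h : R, 0 < h &
  forall t, 0 <= t -> t < h -> forall Z, tau t Z = 0 -> Z = 0.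
Proof.
(* The [d * d] matrix units together contribute at most [d * d * e <= 1/2]; the added 1 keeps the
   denominator nonzero when [d = 0]. *)
pose e : R := (2 * (d * d)%:R + 1)^-1.
have p0 : 0 < 2 * (d * d)%:R + 1 :> R by rewrite ltr_wpDl // mulr_ge0.
have e0 : 0 < e by rewrite invr_gt0.
have smallE (p : 'I_d * 'I_d) : exists2 h : R, 0 < h &
    forall t, 0 <= t -> t < h -> N (tau t (delta_mx p.1 p.2) - delta_mx p.1 p.2) <= e.
  set X := delta_mx _ _; have [dl dl0 H] := tauL X (ltr01).
  pose b := 1 + N (L X); have b0 : 0 < b by rewrite ltr_pwDl.
  exists (Num.min dl (e / b)) => [|t]; first by rewrite lt_min dl0 divr_gt0.
  rewrite le_eqVlt => /orP[/eqP <- _|t0]; first by rewrite tau0 subrr N0 ltW.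
  rewrite lt_min => /andP[tdl teb].
  have -> : tau t X - X = (tau t X - X - rc t *: L X) + rc t *: L X by rewrite subrK.
  apply: le_trans (ND _ _) _; rewrite NZ (nc_rc rc_le rc_nc) ?(ltW t0) //.
  apply: le_trans (lerD (H t t0 tdl) (lexx _)) _.
  by rewrite mul1r -[X in X + _]mulr1 -mulrDr ltW // -ltr_pdivlMr.
have [h hP] := choice (fun p => (let: ex_intro2 h h0 H := smallE p in ex_intro _ h (conj h0 H))).
exists (\big[Num.min/1]_p h p) => [|t t0 th Z tZ].
  by apply: lt_bigmin => // p _; case: (hP p).
apply/N_eq0/eqP; rewrite eq_le N_ge0 andbT.
suff : N (tau t Z - Z) <= 2^-1 * N Z by rewrite tZ sub0r NN; have := N_ge0 Z; lra.
pose D p := tau t (delta_mx p.1 p.2) - delta_mx p.1 p.2.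
have -> : tau t Z - Z = \sum_p Z p.1 p.2 *: D p.
  rewrite {1 2}[Z]matrix_sum_delta !pair_bigA /= linear_sum -sumrB.
  by apply: eq_bigr => p _; rewrite linearZ /= scalerBr.
apply: le_trans (hsn_sum rc_le rc_nc _ _) _.
apply: (@le_trans _ _ (\sum_(p : 'I_d * 'I_d) (e * N Z))).
  apply: ler_sum => p _; rewrite NZ mulrC ler_pM ?N_ge0 ?(nc_ge0 rc_le rc_nc) //.
    by apply: (hP p).2 => //; apply: lt_le_trans th _; exact: bigmin_le_cond.
  exact: (hsn_entry rc_le rc_nc).
rewrite sumr_const card_prod !card_ord -[leLHS]mulr_natl mulrA ler_wpM2r //.
by rewrite /e ler_pdivrMr //; move: (_%:R) => x; lra.
Qed.

(** Cut [t] into equal steps shorter than [h] and undo them one by one. *)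
Lemma tau_injective t Z : 0 <= t -> tau t Z = 0 -> Z = 0.
Proof.
move=> t0; have [h h0 H] := tau_small_injective.
pose n := (Num.truncn (t / h)).+1; have n0 : 0 < n%:R :> R by rewrite ltr0n.
pose s := t / n%:R; have s0 : 0 <= s by rewrite divr_ge0 // ltW.
have sh : s < h by rewrite /s ltr_pdivrMr // mulrC -ltr_pdivrMr // truncnS_gt.
have -> : t = n%:R * s by rewrite /s mulrC divfK // gt_eqF.
elim: n Z {n0 s s0 sh} (s) s0 sh => [|n IH] Z s s0 sh; first by rewrite mul0r tau0.
by rewrite tauS // => /(H _ s0 sh)/IH; apply.
Qed.

(** Commutation with [delta_mx l j], read at entry [(k, j)], says that [X k l] is [X j j] if [k = l]
    and 0 otherwise. *)
Lemma central_scalar X : (forall Y, X *m Y = Y *m X) -> exists c, X = c *: 1%:M.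
Proof.
move=> cX; have [d0|/prednK d0] := posnP d.
  by exists 0; apply/matrixP => i; have := ltn_ord i; rewrite [X in (_ < X)%N]d0.
pose j : 'I_d := cast_ord d0 ord0.
exists (X j j); apply/matrixP => k l; have /matrixP/(_ k j) := cX (delta_mx l j).
rewrite !mxE (bigD1 l) //= [X in _ + X]big1 => [|m ml]; last first.
  by rewrite !mxE (negPf ml) mulr0.
rewrite !mxE !eqxx mulr1 addr0 => ->.
rewrite (bigD1 j) //= [X in _ + X]big1 => [|m mj]; last first.
  by rewrite !mxE (negPf mj) andbF mul0r.
by rewrite !mxE eqxx andbT addr0 mulrC.
Qed.

Lemma hs_trmx X : hs X^T X^T = hs X X.
Proof.
rewrite !hsE exchange_big; apply: eq_bigr => i _; apply: eq_bigr => j _.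
by rewrite !mxE.
Qed.

(** Dual invariance makes the inner product of [X] and [tau t X] equal to [|X|^2], so
    [|tau t X - X|^2 = |tau t X|^2 - |X|^2], which contractivity makes nonpositive. *)
Lemma fixed_of_dual_fixed t X : 0 <= t ->
  (forall Y, hs (tau t Y) X = hs Y X) -> tau t X = X.
Proof.
move=> t0 dX; apply/eqP; rewrite -subr_eq0; apply/eqP/hs_eq0/eqP.
rewrite eq_le hs_ge0 andbT -scaleN1r hsDl !hsDr !hsZl !hsZr dX.
have -> : hs X (tau t X) = hs X X by rewrite -hsC dX hsC.
rewrite rmorphN rmorph1 !mulN1r opprK addNr addr0 subr_le0 -(hsn_le rc_le rc_nc).
exact: tau_contraction.
Qed.

(** A fixed [X] lies in the multiplicative domain, so the left side is the trace of
    [tau t (Y^t* *m X)], and [tau t] preserves traces. *)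
Lemma dual_fixed_of_fixed t X Y : 0 <= t -> tau t X = X -> hs (tau t Y) X = hs Y X.
Proof.
move=> t0 fX; rewrite /hs -tau_adj // -{1}fX -tau_mulMr ?fX //.
exact: tau_tr.
Qed.

(* ei a t stands for e^(i a t). *)
Variable ei : R -> R -> C.
Hypothesis eiD : forall a s t, ei a (s + t) = ei a s * ei a t.
Hypothesis ei_norm : forall a t, nc (ei a t) = 1.
Hypothesis ei_deriv : forall a (e : R), 0 < e -> exists2 delta : R, 0 < delta &
  forall t : R, 0 < t -> t < delta -> nc (ei a t - 1 - rc t * ('i * rc a)%R) <= e * t.
Hypothesis ei0 : forall t, ei 0 t = 1.
Hypothesis ei_neq1 : forall a, a != 0 -> exists2 t, 0 < t & ei a t != 1.

Lemma tau_peripheral a X t : L X = ('i * rc a)%R *: X -> 0 < t -> tau t X = ei a t *: X.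
Proof.
by move=> LX t0; apply: (generator_eigenvector _ _ _ LX t0) => //; exact: ei_deriv.
Qed.

Lemma tau_kernel_fixed X t : L X = 0 -> 0 <= t -> tau t X = X.
Proof.
move=> LX; rewrite le_eqVlt => /orP[/eqP <-|t0]; first exact: tau0.
by rewrite (@tau_peripheral 0) ?ei0 ?scale1r // LX rmorph0 mulr0 scale0r.
Qed.

(* X lies in the multiplicative domains of both tau t and tau t o T, so that
   tau t (X Y) = tau t X * tau t Y = tau t (Y X). *)
Lemma copositive_peripheral_scalar t a X : 0 < t ->
  (forall Z : 'M[C]_(d * 2), psd Z -> psd (tmap (tau t \o trmx) Z)) ->
  L X = ('i * rc a)%R *: X -> exists c, X = c *: 1%:M.
Proof.
move=> t0 cop LX; have t0' := ltW t0.
have iX : N (tau t X) = N X by rewrite (tau_peripheral LX t0) NZ ei_norm mul1r.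
apply: central_scalar => Y; apply/eqP; rewrite -subr_eq0; apply/eqP.
apply: (tau_injective t0'); rewrite linearB /= tau_mulMl // -(trmxK (Y *m X)) trmx_mul.
have := @hs_isometryMl _ _ (tau t \o trmx : {linear Md -> Md}) cop _ _ X^T Y^T.
rewrite /= !trmxK => -> //; first by rewrite subrr.
- by rewrite trmx1 tau1.
- by move=> Z; rewrite tau_tr // mxtrace_tr.
- by rewrite hs_trmx; apply/hsn_eq.
Qed.

Definition isometric X := forall t, 0 <= t -> N (tau t X) = N X.

(** Isometry of [X] alone is enough, by the multiplicative domain; hence the isometric matrices form
    a subspace. *)
Lemma isometric_hs X Y t : isometric X -> 0 <= t -> hs (tau t X) (tau t Y) = hs X Y.
Proof.
move=> iX t0; rewrite /hs -tau_adj // -tau_mulMl ?tau_tr //.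
by rewrite tau_adj // !hsn_adj iX.
Qed.

Lemma isometric_add X Y c : isometric X -> isometric Y -> isometric (X + c *: Y).
Proof.
move=> iX iY t t0; apply/(hsn_eq rc_nc).
rewrite linearD linearZ /= !hsDl !hsDr !hsZl !hsZr !isometric_hs //.
Qed.

Lemma isometric_tau X s : 0 <= s -> isometric X -> isometric (tau s X).
Proof. by move=> s0 iX t t0; rewrite -tauD // !iX // addr_ge0. Qed.

(** The differences [tau h X - X] are isometric and approximate [h *: L X]; contractivity carries
    the approximation through [tau t], with an error [e / 2 * h] on each side. *)
Lemma isometric_generator X : isometric X -> isometric (L X).
Proof.
move=> iX t t0; apply/eqP; rewrite eq_le tau_contraction //= -subr_le0.
apply: eps_le0 => e e0; have e20 : 0 < e / 2 by rewrite divr_gt0.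
have [dl dl0 H] := tauL X e20; pose h := dl / 2.
have h0 : 0 < h by rewrite divr_gt0.
have hdl : h < dl by rewrite ltr_pdivrMr // ltr_pMr // ltr1n.
have := H _ h0 hdl; pose Z := tau h X + (-1) *: X.
have iZ : isometric Z by apply: isometric_add => //; apply: isometric_tau; rewrite ?ltW.
have -> : tau h X - X = Z by rewrite /Z scaleN1r.
have hN W : N (rc h *: W) = h * N W by rewrite NZ (nc_rc rc_le rc_nc) // ltW.
move=> le1.
have le2 : N (rc h *: L X) <= N Z + e / 2 * h.
  apply: le_trans (hsn_dist rc_le rc_nc _ Z) _; rewrite lerD2l.
  by rewrite -NN opprB.
have le3 : N (tau t Z) <= N (rc h *: tau t (L X)) + e / 2 * h.
  apply: le_trans (hsn_dist rc_le rc_nc _ (rc h *: tau t (L X))) _; rewrite lerD2l.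
  have -> : tau t Z - rc h *: tau t (L X) = tau t (Z - rc h *: L X).
    by rewrite [RHS]linearB; congr (_ - _); rewrite [RHS]linearZ.
  exact: le_trans (tau_contraction _ t0) le1.
rewrite iZ // in le3; rewrite !hN in le2 le3.
rewrite -(ler_pM2l h0) mulrBr.
have -> : h * e = e / 2 * h + e / 2 * h by field.
lra.
Qed.

(** The remainder [tau h X - X - rc h *: L X] has trace [- h tr (L X)], yet its norm is small
    compared with [h]. *)
Lemma trace_generator X : \tr (L X) = 0.
Proof.
apply/eqP; rewrite -(nc_eq0 rc_le rc_nc) eq_le (nc_ge0 rc_le rc_nc) andbT.
apply: eps_le0 => e e0; have d0 : 0 < d%:R + 1 :> R by rewrite ltr_wpDl.
have [dl dl0 H] := tauL X (divr_gt0 e0 d0); pose h := dl / 2.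
have h0 : 0 < h by rewrite divr_gt0.
have hdl : h < dl by rewrite ltr_pdivrMr // ltr_pMr // ltr1n.
have := nc_trace rc_le rc_nc (tau h X - X - rc h *: L X).
rewrite !raddfB /= tau_tr ?(ltW h0) // subrr sub0r mxtraceZ.
have -> : nc (- (rc h * \tr (L X))) = h * nc (\tr (L X)).
  by apply: (rc_inj rc_le); rewrite rc_nc rmorphM normrN normrM /= rc_nc ger0_norm // rc_ge0 // ltW.
move=> /le_trans/(_ (ler_wpM2l _ (H h h0 hdl))) le.
rewrite -(ler_pM2l h0); apply: le_trans (le _) _ => //.
rewrite mulrA mulrC ler_pM2l // mulrA ler_pdivrMr // mulrC ler_pM2l // lerDl //.
Qed.

Lemma rc_surj z : z \is Num.real -> exists x, z = rc x.
Proof.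
move=> /real_ge0P[] z0; first by exists (nc z); rewrite rc_nc ger0_norm.
by exists (- nc z); rewrite rmorphN /= rc_nc ltr0_norm // opprK.
Qed.

(** Divide by [t], then take [t] so small that [m * t <= e / 2]. *)
Lemma eps_small (x m : R) : (forall e, 0 < e -> exists2 delta, 0 < delta &
  forall t, 0 < t -> t < delta -> x * t <= e * t + m * t ^+ 2) -> x <= 0.
Proof.
move=> H; apply: eps_le0 => e e0; have [dl dl0 Hd] := H (e / 2) (divr_gt0 e0 (ltr0n _ 2)).
pose t := Num.min (dl / 2) (e / 2 / (`|m| + 1)).
have m1 : 0 < `|m| + 1 by rewrite ltr_wpDl.
have t0 : 0 < t by rewrite lt_min !divr_gt0.
have tdl : t < dl.
  by apply: (@le_lt_trans _ _ (dl / 2)); rewrite ?ge_min ?lexx // ltr_pdivrMr // ltr_pMr // ltr1n.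
have := Hd t t0 tdl; rewrite expr2 mulrA -mulrDl ler_pM2r // => le.
apply: le_trans le _; suff : m * t <= e / 2 by lra.
apply: (@le_trans _ _ ((`|m| + 1) * t)).
  by apply: ler_wpM2r; [exact: ltW | rewrite (le_trans (ler_norm _)) // lerDl].
by rewrite mulrC -ler_pdivlMr // ge_min lexx orbT.
Qed.

(** Since [tau t X] has the norm of [X] and equals [(1 + t mu) X] up to [o(t)], the modulus of
    [1 + t mu] is [1 + o(t)]. Its square is [(1 + t x)^2 + (t a)^2], which forces the real part [x]
    to be zero. *)
Lemma isometric_eigenvalue X mu : isometric X -> X != 0 -> L X = mu *: X ->
  exists a, mu = ('i * rc a)%R.
Proof.
move=> iX X0 LX; have NX : 0 < N X.
  by rewrite lt_neqAle N_ge0 andbT eq_sym; apply: contra_neq X0; exact: N_eq0.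
have [x ex] := rc_surj (Creal_Re mu); have [a ea] := rc_surj (Creal_Im mu).
have emu : mu = rc x + ('i * rc a)%R by rewrite -ex -ea -Crect.
exists a; rewrite emu; suff -> : x = 0 by rewrite rmorph0 add0r.
have ncE t : nc (1 + rc t * mu) ^+ 2 = (1 + t * x) ^+ 2 + (t * a) ^+ 2.
  apply: (rc_inj rc_le); rewrite [LHS]rmorphXn /= rc_nc normCK emu.
  have cr y : Num.conj (rc y) = rc y.
    by apply/CrealP; have [y0|y0] := leP 0 y; [rewrite ger0_real // rc_ge0 // |
      rewrite ler0_real // -(rmorph0 rc) rc_le ltW].
  rewrite !(rmorphXn, rmorphD, rmorphM, rmorph1) /= !cr conjCi.
  have := sqrCi C; set I := ('i)%R => I2.
  transitivity ((1 + rc t * rc x) ^+ 2 - I ^+ 2 * (rc t * rc a) ^+ 2); first by ring.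
  by rewrite I2; ring.
have key e : 0 < e -> exists2 delta, 0 < delta & forall t, 0 < t -> t < delta ->
    `|nc (1 + rc t * mu) - 1| <= e * t.
  move=> e0; have [dl dl0 H] := tauL X (mulr_gt0 e0 NX); exists dl => // t t0 tdl.
  have := H t t0 tdl; rewrite LX.
  have -> : tau t X - X - rc t *: (mu *: X) = tau t X - (1 + rc t * mu) *: X.
    by apply/matrixP => i j; rewrite !mxE; ring.
  move=> le; rewrite -(ler_pM2r NX) mulrAC; apply: le_trans le.
  have -> : `|nc (1 + rc t * mu) - 1| * N X = `|N ((1 + rc t * mu) *: X) - N (tau t X)|.
    rewrite (iX t (ltW t0)) NZ -[X in _ = `|_ - X|]mul1r -mulrBl normrM.
    by rewrite [`|N X|]ger0_norm ?N_ge0.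
  rewrite ler_norml.
  have := hsn_dist rc_le rc_nc (tau t X) ((1 + rc t * mu) *: X).
  have := hsn_dist rc_le rc_nc ((1 + rc t * mu) *: X) (tau t X).
  rewrite [N (_ *: X - _)](hsnBC rc_le rc_nc); lra.
apply/eqP; rewrite eq_le; apply/andP; split.
  apply: (@eps_small _ 0) => e /key[dl dl0 H]; exists dl => // t t0 tdl.
  rewrite mul0r addr0; have := H t t0 tdl; rewrite ler_norml => /andP[_].
  suff : 1 + t * x <= nc (1 + rc t * mu) by rewrite [x * t]mulrC; lra.
  apply: le_trans (ler_norm _) _.
  rewrite -ler_sqr ?nnegrE ?normr_ge0 ?(nc_ge0 rc_le rc_nc) // real_normK ?num_real // ncE.
  by rewrite lerDl sqr_ge0.
(* The constant [x^2 + a^2] is the coefficient of [t^2] in the squared modulus. Taking [t < 1/e]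
   makes [1 - e t] nonnegative, so that squaring preserves the inequality. *)
rewrite -oppr_le0; apply: (@eps_small _ (x ^+ 2 + a ^+ 2)) => e e0.
have [dl dl0 H] := key e e0.
exists (Num.min dl e^-1) => [|t t0]; first by rewrite lt_min dl0 invr_gt0.
rewrite lt_min => /andP[tdl tei].
have := H t t0 tdl; rewrite ler_norml => /andP[le _].
have et : e * t <= 1 by rewrite mulrC -ler_pdivlMr // div1r ltW.
have : (1 - e * t) ^+ 2 <= nc (1 + rc t * mu) ^+ 2.
  by rewrite ler_sqr ?nnegrE ?(nc_ge0 rc_le rc_nc) ?subr_ge0 //; lra.
rewrite ncE; nra.
Qed.

Hypothesis prim : forall X, psd X -> \tr X = 1 ->
  (forall t, 0 <= t -> tau t X = X) -> exists c, X = c *: 1%:M.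

(** [X^t* *m X] is fixed too, by the multiplicative domain; divided by its trace [hs X X] it is a
    density matrix to which [prim] applies. *)
Lemma fixed_gram_scalar X : (forall t, 0 <= t -> tau t X = X) ->
  exists c, X^t* *m X = c *: 1%:M.
Proof.
move=> fX; have [h0|h0] := eqVneq (hs X X) 0.
  by exists 0; rewrite (hs_eq0 h0) mulmx0 scale0r.
have [| | |c ec] := prim (X := (hs X X)^-1 *: (X^t* *m X)).
- by apply: psdZ; [rewrite invr_ge0 hs_ge0 | exact: psd_gram].
- by rewrite mxtraceZ -/(hs X X) mulVf.
- by move=> t t0; rewrite linearZ /= tau_mulMr ?fX // tau_adj // fX.
by exists (hs X X * c); rewrite -scalerA -ec scalerA mulfV // scale1r.
Qed.

(** Polarization: [fixed_gram_scalar] for [X], [X + 1] and [X + 'i] shows that [X] plus its adjoint,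
    and ['i] times the adjoint minus [X], are scalars. *)
Lemma fixed_scalar X : (forall t, 0 <= t -> tau t X = X) -> exists c, X = c *: 1%:M.
Proof.
move=> fX.
have shiftE b : (X + b *: 1%:M)^t* *m (X + b *: 1%:M) =
    X^t* *m X + b *: X^t* + Num.conj b *: X + (b * Num.conj b) *: 1%:M.
  rewrite adjmxD adjmxZ adjmx1 mulmxDl !mulmxDr -!scalemxAl -!scalemxAr !mul1mx !mulmx1.
  by rewrite scalerA [b * _]mulrC !addrA.
have fS b t : 0 <= t -> tau t (X + b *: 1%:M) = X + b *: 1%:M.
  by move=> t0; rewrite linearD linearZ /= fX // tau1.
have [c0 e0] := fixed_gram_scalar fX.
have [c1 e1] := fixed_gram_scalar (fS 1).
have [c2 e2] := fixed_gram_scalar (fS ('i)%R).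
rewrite shiftE e0 conjC1 mulr1 !scale1r in e1.
rewrite shiftE e0 conjCi in e2.
(* The first difference is the scalar of [x + y] and the second that of ['i (y - x)], where [y] is
   the entry of the adjoint; the combination returns [x]. *)
exists ((c1 - c0 - 1 + ('i)%R * (c2 - c0 - 1)) / 2).
apply/matrixP => k l; move/matrixP/(_ k l): e1; move/matrixP/(_ k l): e2.
have := sqrCi C; rewrite !mxE; set I := ('i)%R.
move: (Num.conj _) (X k l) ((k == l)%:R : C) => y x u I2.
have -> : I * - I = 1 by rewrite mulrN -expr2 I2 opprK.
move=> e2 e1.
have -> : (c1 - c0 - 1 + I * (c2 - c0 - 1)) / 2 * u =
    ((c1 - c0 - 1) * u + I * ((c2 - c0 - 1) * u)) / 2.
  by ring.
have -> : (c1 - c0 - 1) * u = x + y.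
  by rewrite !mulrBl -e1; ring.
have -> : (c2 - c0 - 1) * u = I * (y - x).
  by rewrite !mulrBl -e2; ring.
by rewrite mulrA -expr2 I2; field.
Qed.

Lemma ei_natmul a n t : ei a (n%:R * t) = ei a t ^+ n.
Proof.
have e00 : ei a 0 = 1.
  have := eiD a 0 0; rewrite addr0 -[X in X = _]mulr1 => /mulfI -> //.
  by rewrite -(nc_eq0 rc_le rc_nc) ei_norm oner_eq0.
elim: n => [|n IH]; first by rewrite mul0r e00.
by rewrite -nat1r mulrDl mul1r eiD IH exprS.
Qed.

(** Traceless isometric matrices are stable under [shift L], so a nonzero one would give an
    eigenvector [Y] of the same kind with eigenvalue ['i a]. Its Gram matrix is a nonzero scalar, so
    no power [P n] vanishes, and [P n] is an eigenvector of [tau t] for the [n]-th power of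
    [ei a t]. *)
Lemma isometric_trace0_eq0 X : isometric X -> \tr X = 0 -> X = 0.
Proof.
move=> iX tX; apply/eqP; apply: contraT => X0.
have stP Z mu : isometric Z /\ \tr Z = 0 -> isometric (shift L Z mu) /\ \tr (shift L Z mu) = 0.
  move=> [iZ tZ]; split; last by rewrite /shift raddfB /= mxtraceZ tZ mulr0 trace_generator subrr.
  by rewrite /shift -scaleNr; apply: isometric_add => //; exact: isometric_generator.
have [mu [Y [[iY tY] Y0 LY]]] := stable_eigenvector stP (conj iX tX) X0.
have [a ea] := isometric_eigenvalue iY Y0 LY; rewrite {mu}ea in LY.
have tauY t : 0 < t -> tau t Y = ei a t *: Y by exact: tau_peripheral.
have fYY t : 0 <= t -> tau t (Y^t* *m Y) = Y^t* *m Y.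
  rewrite le_eqVlt => /orP[/eqP <-|t0]; first exact: tau0.
  rewrite tau_mulMr ?(ltW t0) ?iY ?(ltW t0) // tau_adj ?(ltW t0) // tauY //.
  rewrite adjmxZ -scalemxAl -scalemxAr scalerA mulrC -normCK.
  by rewrite -rc_nc ei_norm rmorph1 expr1n scale1r.
have [c ec] := fixed_scalar fYY.
have c0 : c != 0.
  apply: contra_neq Y0 => c0; apply: hs_eq0.
  by rewrite /hs ec c0 scale0r mxtrace0.
have YI Z : Y *m Z = 0 -> Z = 0.
  move=> /(congr1 (mulmx (Y^t*))); rewrite mulmxA ec mulmx0 -scalemxAl mul1mx => /eqP.
  by rewrite scaler_eq0 (negPf c0) => /eqP.
pose P n := iter n (mulmx Y) 1%:M.
have P0 n : P n != 0.
  elim: n => [|n IH]; last by apply: contra_neq IH; exact: YI.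
  by apply: contra_neq Y0 => e; rewrite -[Y]mulmx1 [1%:M]e mulmx0.
have tauP t n : 0 < t -> tau t (P n) = ei a t ^+ n *: P n.
  move=> t0; elim: n => [|n IH]; first by rewrite expr0 scale1r tau1 // ltW.
  rewrite [P _]iterS tau_mulMl ?iY ?(ltW t0) // -/(P n) IH tauY //.
  by rewrite -scalemxAl -scalemxAr scalerA exprS.
(* Pigeonhole: the exponents [0] to [d * d] give one more eigenvalue than the annihilating list has
   places, so two powers of [ei a t] coincide. *)
have roots t : 0 < t -> exists2 k, (0 < k <= d * d)%N & ei a t ^+ k = 1.
  move=> t0; have [s ss sP] := exists_annihilator (tau t).
  pose w := [seq ei a t ^+ k | k <- iota 0 (size s).+1].
  have : ~~ uniq w.
    apply/negP => uw; have : {subset w <= s}.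
      by move=> z /mapP[k _ ->]; exact: eigenvalue_annihilator sP (tauP t k t0) (P0 k).
    by move=> /(uniq_leq_size uw); rewrite size_map size_iota ltnn.
  case/(uniqPn 0) => k [l [kl]]; rewrite size_map size_iota => ls.
  rewrite !(nth_map 0%N) ?size_iota ?(ltn_trans kl) // !nth_iota ?(ltn_trans kl) // !add0n => e.
  have E0 : ei a t ^+ k != 0.
    by rewrite expf_neq0 // -(nc_eq0 rc_le rc_nc) ei_norm oner_eq0.
  exists (l - k)%N; first by rewrite subn_gt0 kl /= -ss (leq_trans (leq_subr _ _)).
  apply: (mulfI E0); rewrite mulr1 -exprD subnKC //; exact: ltnW.
have [a0|a0] := eqVneq a 0.
  have [|b eb] := fixed_scalar (X := Y).
    by move=> t t0; apply: tau_kernel_fixed; rewrite // LY a0 rmorph0 mulr0 scale0r.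
  have d0 : d%:R != 0 :> C.
    rewrite pnatr_eq0; apply: contra_neq (P0 0) => d0.
    by apply/matrixP => i; have := ltn_ord i; rewrite [X in (_ < X)%N]d0.
  move: tY; rewrite eb mxtraceZ mxtrace1 => /eqP; rewrite mulf_eq0 (negPf d0) orbF => /eqP b0.
  by move: Y0; rewrite eb b0 scale0r eqxx.
have [t1 t10 /eqP[]] := ei_neq1 a0.
(* The factorial is a multiple of every exponent that [roots] can return; used at time [t1 / m],
   this yields [ei a t1 = 1]. *)
pose m := ((d * d)`!)%N; have m0 : 0 < m%:R :> R by rewrite ltr0n fact_gt0.
rewrite -[t1](divfK (lt0r_neq0 m0)) mulrC ei_natmul.
have [|k kd ek] := roots (t1 / m%:R); first by rewrite divr_gt0.
by have /dvdnP[q eq] := dvdn_fact kd; move: ek; move: (ei a _) => z ek;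
  rewrite /m eq mulnC exprM ek expr1n.
Qed.

Lemma tau_decay_le s t X : 0 <= s -> s <= t -> N (tau t X) <= N (tau s X).
Proof.
by move=> s0 st; rewrite -(subrK s t) tauD ?subr_ge0 // tau_contraction // subr_ge0.
Qed.

(** Induction on the factors. If [|mu| < 1], then [tau (n + 1) X] is [mu *: tau n X] plus the image
    under [tau n] of the shifted matrix, which decays by induction, and [decay_recurrence]
    concludes. *)
Lemma annihilated_decay s X : \tr X = 0 -> foldl (shift (tau 1)) X s = 0 ->
  forall e, 0 < e -> exists n0, forall n, (n0 <= n)%N -> N (tau n%:R X) <= e.
Proof.
have tr_shift Z mu : \tr Z = 0 -> \tr (shift (tau 1) Z mu) = 0.
  by move=> tZ; rewrite /shift raddfB /= mxtraceZ tZ mulr0 tau_tr // tZ subrr.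
have tr_foldl r Z : \tr Z = 0 -> \tr (foldl (shift (tau 1)) Z r) = 0.
  by elim: r Z => //= mu r IH Z /tr_shift/IH.
elim: s X => [|mu s IH] X tX /=.
  by move=> -> e e0; exists 0%N => n _; rewrite linear0 N0 ltW.
move=> sX; have [mu1|mu1] := ltP (nc mu) 1.
  apply: (decay_recurrence mu1 (b := fun n => N (tau n%:R (shift (tau 1) X mu)))) => [n|n|n|].
  - exact: N_ge0.
  - by apply: tau_decay_le; rewrite ?ler_nat.
  - rewrite -natr1 tauD // -NZ; apply: le_trans (ND _ _).
    by rewrite -linearZ -linearD /shift /= addrC subrK.
  - by apply: IH => //; exact: tr_shift.
apply: IH => //; set W := foldl _ X s; have tW : \tr W = 0 by exact: tr_foldl.
have eW : tau 1 W = mu *: W.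
  by apply/eqP; rewrite -subr_eq0; apply/eqP; rewrite -[LHS]/(shift (tau 1) W mu) -shift_foldl.
apply: isometric_trace0_eq0 => // t t0; apply/eqP; rewrite eq_le tau_contraction //=.
have lb n : N W <= N (tau n%:R W).
  elim: n => [|n IHn]; first by rewrite tau0.
  rewrite -natr1 tauD // eW linearZ NZ; apply: le_trans IHn _.
  by rewrite ler_peMl ?N_ge0.
apply: le_trans (lb (Num.truncn t).+1) _; apply: tau_decay_le => //.
by rewrite ltW // truncnS_gt.
Qed.

Lemma trace0_decay X : \tr X = 0 -> forall e, 0 < e ->
  exists2 t0, 0 < t0 & forall t, t0 <= t -> N (tau t X) <= e.
Proof.
move=> tX e e0; have [s _ /(_ X)] := exists_annihilator (tau 1).
move=> /(annihilated_decay tX)/(_ e e0)[n0 H]; exists n0.+1%:R => [|t nt]; first by rewrite ltr0n.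
by apply: le_trans (H n0.+1 _); rewrite ?tau_decay_le.
Qed.

End Semigroups.

(** * Neighbourhood of the depolarizing channel *)

Section DephasingCone.
Variables (C : numClosedFieldType) (d' : nat).
Local Notation d := d'.+1.
Local Notation Md := 'M[C]_d.
Implicit Types (X A B U V : Md) (s : {perm 'I_d}).

Definition depol X : Md := (\tr X / d%:R) *: 1%:M.

Lemma perm_mx_unitary s : (perm_mx s : Md) \is unitarymx.
Proof.
by apply/unitarymxP; rewrite tr_perm_mx map_perm_mx -perm_mxM mulgV perm_mx1.
Qed.

(** A permutation matrix on the right of [U] relabels the prepared basis and leaves the measured one
    alone. *)
Lemma tdeph_perm U V s X : tdeph (U *m perm_mx s^-1) V X =
  \sum_j (V^t* *m X *m V) j j *: (U *m delta_mx (s j) (s j) *m U^t*).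
Proof.
apply: eq_bigr => j _; congr (_ *: _); rewrite adjmxM !mulmxA; congr (_ *m _).
rewrite -!mulmxA; congr (_ *m _); rewrite tr_perm_mx map_perm_mx mulmxA.
rewrite -row_permE -col_permE; apply/matrixP => k l; rewrite !mxE.
have e m : ((s^-1)%g m == j) = (m == s j) by rewrite -(inj_eq (@perm_inj _ s)) permKV.
by rewrite !e.
Qed.

Lemma sum_conj_delta U : U \is unitarymx ->
  \sum_l U *m delta_mx l l *m U^t* = 1%:M.
Proof.
move=> Uu; rewrite -mulmx_suml -mulmx_sumr.
have -> : \sum_l delta_mx l l = 1%:M :> Md.
  by rewrite scalar_mx_sum_delta; apply: eq_bigr => l _; rewrite scale1r.
by rewrite mulmx1; apply/unitarymxP.
Qed.

Lemma trace_conj V X : V \is unitarymx -> \tr (V^t* *m X *m V) = \tr X.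
Proof. by move=> Vu; rewrite mxtrace_mulC mulmxA (unitarymxP Vu) mul1mx. Qed.

Definition cyc (k : 'I_d) : {perm 'I_d} := perm (addrI k).

(** For each measured index [j] the translates [k + j] run once through the prepared basis, whose
    projections add up to the identity. *)
Lemma sum_cyclic_tdeph U V X : U \is unitarymx -> V \is unitarymx ->
  \sum_k tdeph (U *m perm_mx (cyc k)^-1) V X = d%:R *: depol X.
Proof.
move=> Uu Vu; under eq_bigr => k _ do rewrite tdeph_perm.
rewrite exchange_big /= /depol scalerA mulrC divfK ?pnatr_eq0 //.
rewrite -(trace_conj X Vu) /mxtrace scaler_suml; apply: eq_bigr => j _.
rewrite -scaler_sumr -(sum_conj_delta Uu); congr (_ *: _).
rewrite [RHS](reindex_inj (addIr j)) /=; apply: eq_bigr => k _.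
by rewrite permE.
Qed.

Definition dephasing_triple (x : C * (Md * Md)) :=
  [&& 0 <= x.1, x.2.1 \is unitarymx & x.2.2 \is unitarymx].

(** The bound [w] on the total weight is what later decides whether adding [depol] gives a convex
    combination. *)
Definition dephasing_cone (w : C) (Psi : Md -> Md) :=
  exists s : seq (C * (Md * Md)), [/\ all dephasing_triple s,
    \sum_(x <- s) x.1 <= w &
    forall X, Psi X = \sum_(x <- s) x.1 *: (tdeph x.2.1 x.2.2 X - depol X)].

Lemma dephasing_cone_ext w Psi Psi' :
  Psi =1 Psi' -> dephasing_cone w Psi -> dephasing_cone w Psi'.
Proof. by move=> e [s [sg sw sP]]; exists s; split=> // X; rewrite -e. Qed.

Lemma dephasing_cone0 w : 0 <= w -> dephasing_cone w (fun=> 0).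
Proof. by exists [::]; split=> // [|X]; rewrite big_nil. Qed.

Lemma dephasing_coneD w w' Psi Psi' : dephasing_cone w Psi -> dephasing_cone w' Psi' ->
  dephasing_cone (w + w') (fun X => Psi X + Psi' X).
Proof.
move=> [s [sg sw sP]] [s' [sg' sw' sP']]; exists (s ++ s'); split.
- by rewrite all_cat sg.
- by rewrite big_cat lerD.
- by move=> X; rewrite big_cat sP sP'.
Qed.

Lemma dephasing_cone_sum I (r : seq I) (w : I -> C) (Psi : I -> Md -> Md) :
  (forall i, dephasing_cone (w i) (Psi i)) ->
  dephasing_cone (\sum_(i <- r) w i) (fun X => \sum_(i <- r) Psi i X).
Proof.
move=> cP; elim: r => [|i r IH].
  apply: (dephasing_cone_ext (Psi := fun=> 0)) => [X|]; rewrite big_nil //.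
  exact: dephasing_cone0.
rewrite big_cons; apply: dephasing_cone_ext (dephasing_coneD (cP i) IH) => X.
by rewrite big_cons.
Qed.

Lemma dephasing_coneZ c w Psi : 0 <= c -> dephasing_cone w Psi ->
  dephasing_cone (c * w) (fun X => c *: Psi X).
Proof.
move=> c0 [s [sg sw sP]]; exists [seq (c * x.1, x.2) | x <- s]; split.
- rewrite all_map; apply: sub_all sg => x /and3P[x0 xU xV].
  by rewrite /dephasing_triple /= mulr_ge0 //= xU.
- by rewrite big_map -mulr_sumr ler_wpM2l.
- move=> X; rewrite big_map sP scaler_sumr; apply: eq_bigr => x _.
  by rewrite scalerA.
Qed.

Lemma dephasing_cone_base U V : U \is unitarymx -> V \is unitarymx ->
  dephasing_cone 1 (fun X => tdeph U V X - depol X).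
Proof.
move=> Uu Vu; exists [:: (1, (U, V))]; split=> [||X].
- by rewrite /= /dephasing_triple /= ler01 Uu Vu.
- by rewrite big_seq1.
- by rewrite big_seq1 scale1r.
Qed.

(* The cyclic shifts of U average to the depolarizing channel, so the opposite
   of a generator is the sum of its other shifts. *)
Lemma dephasing_cone_opp U V : U \is unitarymx -> V \is unitarymx ->
  dephasing_cone d'%:R (fun X => depol X - tdeph U V X).
Proof.
move=> Uu Vu.
have e : \sum_(k <- [seq k <- index_enum 'I_d | k != 0]) 1 = d'%:R :> C.
  by rewrite big_filter sumr_const cardC1 card_ord.
rewrite -e; apply: dephasing_cone_ext (dephasing_cone_sum _ (w := fun=> 1)
  (Psi := fun k X => tdeph (U *m perm_mx (cyc k)^-1) V X - depol X) _) => [X|k]; last first.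
  by apply: dephasing_cone_base => //; rewrite mul_unitarymx // perm_mx_unitary.
have := sum_cyclic_tdeph X Uu Vu; rewrite (bigD1 0) //=.
have -> : cyc 0 = 1%g by apply/permP => k; rewrite permE perm1 add0r.
rewrite invg1 perm_mx1 mulmx1 big_filter sumrB sumr_const cardC1 card_ord /=.
rewrite -[in d%:R]addn1 natrD scalerDl scale1r scaler_nat addrC => /eqP.
rewrite -subr_eq => /eqP eS; rewrite -[LHS]addr0 -{2}(subrr (depol X *+ d')) -eS.
by rewrite addrAC -addrA opprD; apply/matrixP => i j; rewrite !mxE; ring.
Qed.

(** In the bases of [V] and [U], these are the elementary tensors of the traceless diagonal matrices
    [e_jj - e_00] and [e_ll - e_00]. *)
Definition swap_map U V (j l : 'I_d) X : Md :=
  ((V^t* *m X *m V) j j - (V^t* *m X *m V) 0 0) *: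
  (U *m delta_mx l l *m U^t* - U *m delta_mx 0 0 *m U^t*).

Lemma swap_map_cone U V j l (r : C) : U \is unitarymx -> V \is unitarymx ->
  r \is Num.real -> dephasing_cone (`|r| * d%:R) (fun X => r *: swap_map U V j l X).
Proof.
move=> Uu Vu rr; have z0 : 0 <= `|r| * d%:R by rewrite mulr_ge0.
have [->|j0] := eqVneq j 0.
  apply: dephasing_cone_ext (dephasing_cone0 z0) => X.
  by rewrite /swap_map subrr scale0r scaler0.
have [->|l0] := eqVneq l 0.
  apply: dephasing_cone_ext (dephasing_cone0 z0) => X.
  by rewrite /swap_map subrr !scaler0.
(* [s] sends [j] to [l] and fixes 0, [s'] sends [j] to 0 and 0 to [l], and they agree elsewhere; the
   difference of the two dephasings is therefore the swap map. *)
pose s := tperm j l; pose s' := (tperm j l * tperm l 0)%g.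
have eD X : swap_map U V j l X =
    tdeph (U *m perm_mx s^-1) V X - tdeph (U *m perm_mx s'^-1) V X.
  rewrite !tdeph_perm -sumrB (bigD1 j) //= (bigD1 0) /=; last by rewrite eq_sym.
  rewrite [X in _ = _ + (_ + X)]big1 => [|k /andP[kj k0]]; last first.
    rewrite /s' permM /s; have [e|kl] := eqVneq k l.
      by rewrite -e tpermR tpermD ?subrr // eq_sym.
    by rewrite (@tpermD _ j l k) 1?eq_sym // tpermD ?subrr // eq_sym.
  rewrite /s' !permM /s !tpermL (@tpermD _ j l 0) // tpermR addr0.
  rewrite /swap_map; move: (U *m delta_mx l l *m _) (U *m delta_mx 0 0 *m _) => F G.
  move: (_ j j) (_ 0 0) => x y; by apply/matrixP => k m; rewrite !mxE; ring.
have cU t : U *m perm_mx t \is unitarymx by rewrite mul_unitarymx // perm_mx_unitary.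
have pos (c : C) t t' : 0 <= c -> dephasing_cone (c * d%:R)
    (fun X => c *: (tdeph (U *m perm_mx t) V X - tdeph (U *m perm_mx t') V X)).
  move=> c0; apply: dephasing_coneZ => //; rewrite -nat1r.
  have := dephasing_coneD (dephasing_cone_base (cU t) Vu) (dephasing_cone_opp (cU t') Vu).
  by apply: dephasing_cone_ext => X; rewrite addrA subrK.
have [r0|r0] := real_ge0P rr.
  by apply: dephasing_cone_ext (pos _ s^-1 s'^-1 r0)%g => X; rewrite eD.
have nr : 0 <= - r by rewrite oppr_ge0 ltW.
by apply: dephasing_cone_ext (pos _ s'^-1 s^-1 nr)%g => X; rewrite eD scaleNr -scalerN opprB.
Qed.

Lemma trace_conj_delta U j : U \is unitarymx -> \tr (U *m delta_mx j j *m U^t*) = 1.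
Proof.
move=> Uu; rewrite mxtrace_mulC mulmxA adjmx_unitary // mul1mx.
by rewrite -[delta_mx _ _]mulmx1 trace_delta_mul mxE eqxx.
Qed.

(** Diagonalize [A] and [B]. Their eigenvalues sum to zero, so the term of index 0 may be subtracted
    freely in both expansions, leaving a real combination of swap maps. *)
Lemma rank_one_cone A B : A^t* = A -> B^t* = B -> \tr A = 0 -> \tr B = 0 ->
  exists2 w, 0 <= w & forall r : C, r \is Num.real ->
    dephasing_cone (`|r| * w) (fun X => (r * \tr (A *m X)) *: B).
Proof.
move=> hA hB tA tB; have [V Vu [a ar eA]] := herm_spectral hA.
have [U Uu [b br eB]] := herm_spectral hB.
have sa : \sum_j a j = 0.
  transitivity (\tr A) => //; rewrite eA raddf_sum; apply: eq_bigr => j _.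
  by rewrite /= mxtraceZ trace_conj_delta // mulr1.
have sb : \sum_j b j = 0.
  transitivity (\tr B) => //; rewrite eB raddf_sum; apply: eq_bigr => j _.
  by rewrite /= mxtraceZ trace_conj_delta // mulr1.
have eT X : \tr (A *m X) = \sum_j a j * ((V^t* *m X *m V) j j - (V^t* *m X *m V) 0 0).
  under [RHS]eq_bigr => j _ do rewrite mulrBr.
  rewrite sumrB -mulr_suml sa mul0r subr0 eA mulmx_suml raddf_sum; apply: eq_bigr => j _.
  rewrite /= -scalemxAl mxtraceZ; congr (_ * _).
  by rewrite -!mulmxA mxtrace_mulC -mulmxA trace_delta_mul !mulmxA.
have eBB : B = \sum_l b l *: (U *m delta_mx l l *m U^t* - U *m delta_mx 0 0 *m U^t*).
  under eq_bigr => l _ do rewrite scalerBr.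
  by rewrite sumrB -scaler_suml sb scale0r subr0.
exists (\sum_p `|a p.1 * b p.2| * d%:R) => [|r rr].
  by apply: sumr_ge0 => p _; rewrite mulr_ge0.
rewrite mulr_sumr.
apply: dephasing_cone_ext (dephasing_cone_sum _ (w := fun p => `|r| * (`|a p.1 * b p.2| * d%:R))
  (Psi := fun p X => (r * (a p.1 * b p.2)) *: swap_map U V p.1 p.2 X) _) => [X|p]; last first.
  by rewrite mulrA -normrM; apply: swap_map_cone => //; rewrite !realM.
rewrite eT [in RHS]eBB -(pair_bigA _ (fun j l => (r * (a j * b l)) *: swap_map U V j l X)) /=.
rewrite mulr_sumr scaler_suml; apply: eq_bigr => j _.
rewrite scaler_sumr; apply: eq_bigr => l _; rewrite /swap_map !scalerA.
by congr (_ *: _); ring.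
Qed.


(** A redundant Hermitian spanning family: both orders of each index pair are kept, and diagonal
    pairs are included. *)
Definition frame_mx (q : ('I_d * 'I_d) * bool) : Md :=
  if q.2 then delta_mx q.1.1 q.1.2 + delta_mx q.1.2 q.1.1
  else ('i)%R *: (delta_mx q.1.1 q.1.2 - delta_mx q.1.2 q.1.1).

Lemma frame_mx_herm q : (frame_mx q)^t* = frame_mx q.
Proof.
case: q => -[j k] []; rewrite /frame_mx /=.
  by rewrite adjmxD !adjmx_delta addrC.
by rewrite adjmxZ adjmxB !adjmx_delta conjCi scaleNr -scalerN opprB.
Qed.

(** The two matrices attached to [(j, k)] reproduce twice the entries at [(j, k)] and [(k, j)];
    summed over ordered pairs, every entry is counted four times. *)
Lemma frame_mxE X : X = 4^-1 *: \sum_q \tr (frame_mx q *m X) *: frame_mx q.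
Proof.
rewrite -(pair_bigA _ (fun p b => \tr (frame_mx (p, b) *m X) *: frame_mx (p, b))) /=.
transitivity (4^-1 *: \sum_(p : 'I_d * 'I_d) (2 * X p.1 p.2 *: delta_mx p.1 p.2
    + 2 * X p.2 p.1 *: delta_mx p.2 p.1)).
  rewrite big_split /=.
  rewrite [X in _ *: (_ + X)](reindex (fun p : 'I_d * 'I_d => (p.2, p.1))) /=; last first.
    by exists (fun p => (p.2, p.1)) => -[].
  under eq_bigr => p _ do rewrite -scalerA.
  rewrite -scaler_sumr -(pair_bigA _ (fun j k => X j k *: delta_mx j k)) /= -matrix_sum_delta.
  by apply/matrixP => k l; rewrite !mxE; field.
congr (_ *: _); apply: eq_bigr => -[j k] _; rewrite big_bool /frame_mx /=.
rewrite -scalemxAl mulmxDl mulmxBl mxtraceZ mxtraceD [\tr (_ - _)]raddfB /= !trace_delta_mul.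
have := sqrCi C; set I := ('i)%R => I2; rewrite scalerA.
rewrite [I * _ * I]mulrAC -expr2 I2 mulN1r.
by move: (delta_mx j k) (delta_mx k j) => D D'; apply/matrixP => m n; rewrite !mxE; ring.
Qed.

Definition traceless X : Md := X - depol X.

Lemma trace_depol X : \tr (depol X) = \tr X.
Proof. by rewrite mxtraceZ mxtrace1 divfK ?pnatr_eq0. Qed.

Lemma trace_traceless X : \tr (traceless X) = 0.
Proof. by rewrite raddfB /= trace_depol subrr. Qed.

Lemma conj_trace X : Num.conj (\tr X) = \tr (X^t*).
Proof. by rewrite trace_map_mx mxtrace_tr. Qed.

Lemma traceless_herm X : X^t* = X -> (traceless X)^t* = traceless X.
Proof.
move=> hX; have trX : Num.conj (\tr X) = \tr X.
  by rewrite conj_trace hX.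
rewrite /traceless adjmxB hX adjmxZ adjmx1 rmorphM fmorphV rmorph_nat /=.
by rewrite trX.
Qed.

Lemma trace_mul_traceless A X : \tr (A *m traceless X) = \tr (traceless A *m X).
Proof.
rewrite /traceless mulmxBl mulmxBr !raddfB /= /depol -scalemxAr -scalemxAl.
by rewrite mulmx1 mul1mx !mxtraceZ mulrAC [\tr X * _]mulrC mulrAC.
Qed.

(** [Psi] sees only the traceless part of its input and its output is traceless; both are expanded
    by [frame_mxE], whence [16 = 4 * 4]. *)
Lemma frame_decomposition (Psi : {linear Md -> Md}) X :
  Psi 1%:M = 0 -> (forall Y, \tr (Psi Y) = 0) ->
  Psi X = \sum_q \sum_q' (16^-1 * \tr (frame_mx q' *m Psi (frame_mx q)) *
    \tr (traceless (frame_mx q) *m X)) *: traceless (frame_mx q').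
Proof.
move=> Psi1 Psitr.
have PX : Psi X = Psi (traceless X).
  by rewrite /traceless linearB linearZ /= Psi1 scaler0 subr0.
have tl Y : \tr Y = 0 -> Y = 4^-1 *: \sum_q \tr (frame_mx q *m Y) *: traceless (frame_mx q).
  move=> tY; have tlZ c Z : c *: traceless Z = traceless (c *: Z).
    by rewrite /traceless /depol mxtraceZ scalerBr scalerA mulrA.
  have tlS (F : ('I_d * 'I_d) * bool -> Md) : \sum_q traceless (F q) = traceless (\sum_q F q).
    by rewrite /traceless /depol sumrB -scaler_suml -mulr_suml [\tr _]raddf_sum.
  under eq_bigr => q _ do rewrite tlZ.
  by rewrite tlS tlZ -frame_mxE /traceless /depol tY mul0r scale0r subr0.
rewrite PX {1}(frame_mxE (traceless X)) linearZ /=.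
have -> : Psi (\sum_q \tr (frame_mx q *m traceless X) *: frame_mx q) =
    \sum_q Psi (\tr (frame_mx q *m traceless X) *: frame_mx q) by rewrite linear_sum.
rewrite scaler_sumr; apply: eq_bigr => q _; rewrite linearZ /= trace_mul_traceless.
rewrite {1}(tl _ (Psitr (frame_mx q))).
rewrite !scaler_sumr; apply: eq_bigr => q' _; rewrite !scalerA.
by congr (_ *: _); field.
Qed.

(** Named so that it carries a linear structure and can stand for [Psi] in [near_depol_mixed]. *)
Definition depol_defect (phi : Md -> Md) X : Md := phi X - depol X.

Lemma depol_defect_linear (phi : {linear Md -> Md}) : linear (depol_defect phi).
Proof.
move=> c X Y; rewrite /depol_defect /depol linearP mxtraceD mxtraceZ.
by apply/matrixP => i j; rewrite !mxE; ring.
Qed.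

HB.instance Definition _ (phi : {linear Md -> Md}) :=
  GRing.isLinear.Build C Md Md *:%R (depol_defect phi) (depol_defect_linear phi).

(** Each term of [frame_decomposition] lies in the cone with weight proportional to its coefficient,
    which is real because [Psi] commutes with adjoints. Small coefficients keep the total weight at
    most 1. *)
Lemma near_depol_mixed : exists2 e : C, 0 < e &
  forall Psi : {linear Md -> Md}, Psi 1%:M = 0 -> (forall Y, \tr (Psi Y) = 0) ->
    (forall Y, Psi (Y^t*) = (Psi Y)^t*) ->
    (forall q q', `|\tr (frame_mx q' *m Psi (frame_mx q))| <= e) ->
  exists (m : nat) (p : 'I_m -> C) (U V : 'I_m -> Md),
    [/\ forall j, 0 <= p j, \sum_j p j = 1,
        forall j, U j \is unitarymx /\ V j \is unitarymx &
        forall X, depol X + Psi X = \sum_j p j *: tdeph (U j) (V j) X].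
Proof.
have wP q q' := rank_one_cone (traceless_herm (frame_mx_herm q))
  (traceless_herm (frame_mx_herm q')) (trace_traceless _) (trace_traceless _).
pose w q q' := s2val (cid2 (wP q q')).
have w0 q q' : 0 <= w q q' by rewrite /w; case: cid2.
have wC q q' (r : C) : r \is Num.real -> dephasing_cone (`|r| * w q q')
    (fun X => (r * \tr (traceless (frame_mx q) *m X)) *: traceless (frame_mx q')).
  by rewrite /w; case: cid2 => v v0 H; exact: H.
pose W := \sum_q \sum_q' w q q'.
have W0 : 0 <= W by apply: sumr_ge0 => q _; apply: sumr_ge0 => q' _.
have W1 : 0 < W + 1 by rewrite ltr_wpDl.
(* Coefficients of this size give total weight at most [W / (W + 1)]. *)
exists (W + 1)^-1 => [|Psi Psi1 Psitr Psiadj small]; first by rewrite invr_gt0.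
pose r q q' := 16^-1 * \tr (frame_mx q' *m Psi (frame_mx q)).
have rr q q' : r q q' \is Num.real.
  rewrite realM ?realV ?realn //; apply/CrealP.
  by rewrite conj_trace adjmxM -Psiadj !frame_mx_herm mxtrace_mulC.
have [s [sg sw sP]] : dephasing_cone 1 Psi.
  have [s [sg sw sP]] := dephasing_cone_sum (index_enum _)
    (fun q => dephasing_cone_sum (index_enum _) (fun q' => wC q q' _ (rr q q'))).
  exists s; split=> [//||X]; last by rewrite -sP; exact: frame_decomposition.
  apply: le_trans sw _; apply: (@le_trans _ _ ((W + 1)^-1 * W)).
    rewrite mulr_sumr; apply: ler_sum => q _; rewrite mulr_sumr; apply: ler_sum => q' _.
    apply: ler_wpM2r => //; rewrite normrM -[leRHS]mul1r ler_pM //.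
    by rewrite ger0_norm ?invr_ge0 // invf_le1 ?ler1n ?ltr0n.
  by rewrite mulrC ler_pdivrMr // mul1r lerDl.
(* The weight left over is spent on [depol], spread evenly over the [d] cyclic dephasings whose
   average it is. *)
pose c := (1 - \sum_(x <- s) x.1) / d%:R.
have c0 : 0 <= c by rewrite divr_ge0 // subr_ge0.
pose s' := s ++ [seq (c, (1%:M *m perm_mx (cyc k)^-1, 1%:M)) | k <- index_enum 'I_d].
have U1 : (1%:M : Md) \is unitarymx by apply/unitarymxP; rewrite adjmx1 mulmx1.
have s'g : all dephasing_triple s'.
  rewrite all_cat sg all_map; apply/allP => k _ /=.
  by rewrite /dephasing_triple /= c0 U1 mul_unitarymx // perm_mx_unitary.
pose t := in_tuple s'.
exists (size s'), (fun j => (tnth t j).1), (fun j => (tnth t j).2.1), (fun j => (tnth t j).2.2).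
have tg j : dephasing_triple (tnth t j) by apply: (allP s'g); exact: mem_tnth.
split=> [j||j|X].
- by case/and3P: (tg j).
- rewrite -(big_tuple _ _ _ xpredT (fun x => x.1)) big_cat big_map /= sumr_const card_ord.
  by rewrite -mulr_natr divfK ?pnatr_eq0 // addrC subrK.
- by case/and3P: (tg j).
rewrite -(big_tuple _ _ _ xpredT (fun x => x.1 *: tdeph x.2.1 x.2.2 X)) big_cat big_map /=.
rewrite -scaler_sumr sum_cyclic_tdeph // scalerA divfK ?pnatr_eq0 //.
have -> : Psi X = \sum_(x <- s) x.1 *: tdeph x.2.1 x.2.2 X - (\sum_(x <- s) x.1) *: depol X.
  by rewrite sP scaler_suml -sumrB; apply: eq_bigr => x _; rewrite scalerBr.
by rewrite scalerBl scale1r addrCA.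
Qed.

End DephasingCone.

(** * Limits of matrices over R[i] *)

Lemma scaled_difference (C : numClosedFieldType) d (c u : C) (X Y : 'M[C]_d) :
  c * u = 1 -> Y - c *: X = - c *: (X - u *: Y).
Proof.
by move=> cu; rewrite scaleNr scalerBr scalerA cu scale1r opprB.
Qed.

Section ComplexNumbers.
Variable R : realType.
Local Notation C := R[i].
Local Notation rc := (real_complex R : {rmorphism R -> C}).
Local Notation nc := (@Normc.normc R : C -> R).

Lemma real_complex_le x y : (rc x <= rc y) = (x <= y).
Proof. exact: lecR. Qed.

Lemma real_complex_normc (z : C) : rc (nc z) = `|z|.
Proof. by []. Qed.

(** The exponential [e^(i a t)], which instantiates [ei]. *)
Definition cis (a t : R) : C := cos (a * t) +i* sin (a * t).

Lemma cisD a s t : cis a (s + t) = cis a s * cis a t.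
Proof.
rewrite /cis mulrDr cosD sinD.
by apply/eqP; rewrite eq_complex /= eqxx addrC [X in _ + X]mulrC eqxx.
Qed.

Lemma cis_norm a t : nc (cis a t) = 1.
Proof. by rewrite /= cos2Dsin2 sqrtr1. Qed.

Lemma cis0 t : cis 0 t = 1.
Proof. by rewrite /cis mul0r cos0 sin0. Qed.

Lemma cis_neq1 a : a != 0 -> exists2 t, 0 < t & cis a t != 1.
Proof.
move=> a0; have na : 0 < `|a| by rewrite normr_gt0.
exists (pi / `|a|); first by rewrite divr_gt0 // pi_gt0.
have e : cos (a * (pi / `|a|)) = -1.
  have [a1|a1] := ltP 0 a.
    by rewrite gtr0_norm // mulrC divfK // cospi.
  by rewrite ler0_norm // invrN mulrN mulrN mulrC divfK // cosN cospi.
rewrite eq_complex /= e negb_and; apply/orP; left.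
by rewrite lt_eqF // (lt_trans _ (ltr01)) // ltrN10.
Qed.

Lemma imaginaryE : ('i)%R = 'i :> C.
Proof. by []. Qed.

Lemma derive0_small (f : R -> R) (df : R) : is_derive (0 : R) (1 : R) f df -> forall e, 0 < e ->
  exists2 delta : R, 0 < delta & forall t, 0 < t -> t < delta ->
    `|f t - f 0 - t * df| <= e * t.
Proof.
move=> [fd <-] e e0; have := fd; rewrite /derivable => /cvgrPdist_le/(_ e e0).
move=> /nbhs_ballP[dl /= dl0 H]; exists dl => // t t0 tdl.
have := H t; rewrite /ball /= sub0r normrN gtr0_norm // => /(_ tdl (lt0r_neq0 t0)).
rewrite addr0 (_ : t%:A = t :> R); last exact: mulr1.
move=> le; have -> : `|f t - f 0 - t * 'D_1 f 0| = `|'D_1 f 0 - t^-1 *: (f t - f 0)| * t.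
  rewrite -[X in _ = _ * X](gtr0_norm t0) -normrM mulrBl -[_ *: _]/(_ * _).
  rewrite mulrAC mulVf ?gt_eqF // mul1r.
  by rewrite distrC [_ * t]mulrC.
by rewrite ler_pM2r.
Qed.

Lemma cis_deriv a (e : R) : 0 < e -> exists2 delta : R, 0 < delta &
  forall t : R, 0 < t -> t < delta -> nc (cis a t - 1 - rc t * ('i * rc a)%R) <= e * t.
Proof.
move=> e0; have e20 : 0 < e / 2 by rewrite divr_gt0.
have da : is_derive (0 : R) (1 : R) (fun t => a * t) a.
  by have := is_deriveZ a (is_derive_id (0 : R) (1 : R)); rewrite [a *: 1]mulr1.
have dc : is_derive (0 : R) (1 : R) (fun t => cos (a * t)) 0.
  have := is_derive1_comp (is_derive_cos (a * 0)) da.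
  by rewrite mulr0 sin0 oppr0 mul0r.
have ds : is_derive (0 : R) (1 : R) (fun t => sin (a * t)) a.
  have := is_derive1_comp (is_derive_sin (a * 0)) da.
  by rewrite mulr0 cos0 mul1r.
have [d1 d10 H1] := derive0_small dc e20; have [d2 d20 H2] := derive0_small ds e20.
exists (Num.min d1 d2) => [|t t0]; first by rewrite lt_min d10.
rewrite lt_min => /andP[td1 td2].
have := H1 t t0 td1; have := H2 t t0 td2; rewrite !mulr0 cos0 sin0 !subr0 => le2 le1.
have -> : cis a t - 1 - rc t * ('i * rc a)%R = rc (cos (a * t) - 1) + 'i * rc (sin (a * t) - t * a).
  apply/eqP; rewrite imaginaryE eq_complex /=; apply/andP; split; apply/eqP; ring.
apply: le_trans (ncD real_complex_le real_complex_normc _ _) _.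
rewrite (ncM real_complex_le real_complex_normc).
have nr x : nc (rc x) = `|x| by rewrite /= expr0n addr0 sqrtr_sqr.
have -> : nc ('i : C) = 1 by rewrite /= expr0n add0r expr1n sqrtr1.
rewrite !nr mul1r; lra.
Qed.

End ComplexNumbers.

Section Limits.
Variables (R : realType) (d : nat).
Local Notation C := R[i].
Local Notation Md := 'M[C]_d.
Local Notation N := (@hsn R C (@Normc.normc R) d).
Let le_rc := @real_complex_le R.
Let rc_nc := @real_complex_normc R.

(** Links the entrywise topology, whose balls have radii in [C], to estimates in [R], through the
    two-sided comparison of [hsn] with the entries. *)
Lemma cvg_hsnP (T : Type) (F : set_system T) (FF : Filter F) (f : T -> Md) (l : Md) :
  f t @[t --> F] --> l <-> forall e : R, 0 < e -> \forall t \near F, N (l - f t) <= e.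
Proof.
split=> [/cvg_ballP H e e0|H].
  (* The error [e] is shared among all entries; the added 1 avoids a division by zero when
     [d = 0]. *)
  pose n : R := #|{: 'I_d * 'I_d}|%:R + 1.
  have n0 : 0 < n by rewrite ltr_wpDl.
  have en : 0 < (e / n)%:C :> C by rewrite ltcR divr_gt0.
  apply: filterS (H _ en) => t [_ B].
  apply: le_trans (hsn_le_entries le_rc rc_nc _) _.
  apply: (@le_trans _ _ (\sum_(p : 'I_d * 'I_d) e / n)).
    apply: ler_sum => p _; rewrite ltW // -ltcR; have := B p.1 p.2.
    by rewrite /ball /= !mxE -rc_nc.
  rewrite sumr_const -[leLHS]mulr_natl mulrA ler_pdivrMr // mulrC ler_pM2l //.
  by rewrite lerDl.
apply/cvg_ballP => e e0; have e1 : 0 < complex.Re e / 2.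
  by move: e0; rewrite ltcE => /andP[_ re]; rewrite divr_gt0.
apply: filterS (H _ e1) => t le; split=> // i j; rewrite /ball /=.
have -> : e = (complex.Re e)%:C by rewrite RRe_real // ger0_real // ltW.
rewrite -rc_nc ltcR; have := hsn_entry le_rc rc_nc (l - f t) i j; rewrite !mxE => le1.
apply: le_lt_trans le1 _; apply: le_lt_trans le _.
by rewrite ltr_pdivrMr // ltr_pMr ?ltr1n //; move: e0; rewrite ltcE => /andP[].
Qed.

Lemma generator_bound (tau : R -> {linear Md -> Md}) (L : {linear Md -> Md}) :
  generator tau L -> forall X (e : R), 0 < e -> exists2 delta : R, 0 < delta &
    forall t : R, 0 < t -> t < delta -> N (tau t X - X - real_complex R t *: L X) <= e * t.
Proof.
move=> hL X e e0; have /cvg_hsnP/(_ e e0) := hL X.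
move=> /nbhs_ballP[dl /= dl0 H]; exists dl => // t t0 tdl.
have := H t; rewrite /ball /= sub0r normrN gtr0_norm // => /(_ tdl t0).
have tC : t%:C != 0 :> C by rewrite eq_complex /= eqxx andbT gt_eqF.
have -> : L X - (t^-1)%:C *: (tau t X - X) = (- (t^-1)%:C) *: (tau t X - X - t%:C *: L X).
  apply: scaled_difference.
  by rewrite -(rmorphM (real_complex R)) /= mulVf ?gt_eqF.
rewrite (hsnZ le_rc rc_nc).
have -> : Normc.normc (- (t^-1)%:C) = t^-1.
  by rewrite /= oppr0 expr0n addr0 sqrrN sqrtr_sqr gtr0_norm // invr_gt0.
by rewrite mulrC ler_pdivrMr.
Qed.

End Limits.

(** * From 2-copositivity to convergence *)

Section Equivalences.
Variables (R : realType) (d : nat).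
Local Notation C := R[i].
Local Notation Md := 'M[C]_d.
Local Notation N := (@hsn R C (@Normc.normc R) d).
Variables (tau : R -> {linear Md -> Md}) (L : {linear Md -> Md}).
Hypothesis hd : (0 < d)%N.
Hypothesis htau : quantum_markov_semigroup tau.
Hypothesis htp : forall t, 0 <= t -> trace_preserving (tau t).
Hypothesis hL : generator tau L.
Let le_rc := @real_complex_le R.
Let rc_nc := @real_complex_normc R.

Let tau0 X : tau 0 X = X.
Proof. by case: htau => -[] -> . Qed.

Let tauD (s t : R) X : 0 <= s -> 0 <= t -> tau (s + t) X = tau s (tau t X).
Proof. by move=> s0 t0; case: htau => -[_ + _] _; move=> ->. Qed.

Let tau2 (t : R) : 0 <= t -> forall Z : 'M[C]_(d * 2), psd Z -> psd (tmap (tau t) Z).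
Proof. by move=> t0 Z Zp; case: htau => _ /(_ t t0)[_ cp]; exact: (cp 2). Qed.

Let tau1 (t : R) : 0 <= t -> tau t 1%:M = 1%:M.
Proof. by move=> t0; case: htau => _ /(_ t t0)[]. Qed.

Let tau_tr (t : R) X : 0 <= t -> \tr (tau t X) = \tr X.
Proof. by move=> t0; exact: htp. Qed.

Let tauL := generator_bound hL.

Let d_neq0 : d%:R != 0 :> C.
Proof. by rewrite pnatr_eq0 -lt0n. Qed.

(** Replaces invariance under the adjoint maps, as in [primitive], by being fixed under the
    semigroup itself. *)
Lemma invariantP X : Defs.invariant tau X <-> forall t, 0 <= t -> tau t X = X.
Proof.
split=> iX t t0.
  apply: (fixed_of_dual_fixed le_rc rc_nc tau2 tau1 tau_tr t0) => Y.
  by have := hs_adjointP (tau t) Y X; rewrite iX.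
apply/matrixP => i j; rewrite mxE.
transitivity (hs (delta_mx i j) X).
  exact: (dual_fixed_of_fixed rc_nc tau2 tau1 tau_tr _ t0 (iX t t0)).
by rewrite /hs adjmx_delta trace_delta_mul.
Qed.

Lemma copositive_boundary : eventually_has (@copositive R d 2) tau ->
  peripheral_poisson_boundary L = [set c *: 1%:M | c in [set: C]].
Proof.
move=> [t0 t00 cop]; apply/seteqP; split=> X.
  move=> [m [c [Y [HY ->]]]].
  have sY j : exists b : C, Y j = b *: 1%:M.
    have [a LY] := HY j.
    exact: (copositive_peripheral_scalar le_rc rc_nc tau0 tauD tau2 tau1 tau_tr tauL
      (@cisD R) (@cis_norm R) (@cis_deriv R) t00 (cop t0 (lexx _)) LY).
  have [b eb] := choice sY.
  exists (\sum_j c j * b j) => //; rewrite scaler_suml; apply: eq_bigr => j _.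
  by rewrite eb scalerA.
(* Scalars lie in the boundary with [a = 0], because the identity is fixed and so killed by [L]. *)
move=> [c _ <-]; exists 1, (fun=> c), (fun=> 1%:M); split; last by rewrite big_ord1.
move=> _; exists 0; rewrite (fixed_generator le_rc rc_nc tauL) //.
by rewrite rmorph0 mulr0 scale0r.
Qed.

Lemma density_max_mixed : density (d%:R^-1 *: 1%:M : Md).
Proof.
split; last by rewrite mxtraceZ mxtrace1 mulVf.
by apply: psdZ; [rewrite invr_ge0 ler0n | exact: psd1].
Qed.

Lemma invariant_max_mixed : Defs.invariant tau (d%:R^-1 *: 1%:M : Md).
Proof. by apply/invariantP => t t0; rewrite linearZ /= tau1. Qed.

(** The invariant state is the maximally mixed one. Any other invariant density is fixed, hence in
    the kernel of [L] and in the boundary, so it is scalar, and its trace determines it. *)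
Lemma boundary_primitive :
  peripheral_poisson_boundary L = [set c *: 1%:M | c in [set: C]] -> primitive tau.
Proof.
move=> bd; exists (d%:R^-1 *: 1%:M); split.
- exact: density_max_mixed.
- move=> v v0; rewrite -scalemxAr -scalemxAl mulmx1 mxE.
  rewrite mulr_gt0 ?invr_gt0 ?ltr0n //.
  have := dotmx_is_dotmx (u := v^t*).
  rewrite dotmxE trmxCK; apply; apply: contra_neq v0 => v0.
  by rewrite -[v]trmxCK v0 trmx0 map_mx0.
- exact: invariant_max_mixed.
move=> sigma [_ tr1] /invariantP fs.
have Ls : L sigma = 0 by exact: (fixed_generator le_rc rc_nc tauL).
have : peripheral_poisson_boundary L sigma.
  exists 1, (fun=> 1), (fun=> sigma); split; last by rewrite big_ord1 scale1r.
  by move=> _; exists 0; rewrite Ls rmorph0 mulr0 scale0r.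
rewrite bd => -[c _ ec]; move: tr1; rewrite -ec mxtraceZ mxtrace1 => c1.
by congr (_ *: _); apply: (mulIf d_neq0); rewrite c1 mulVf.
Qed.

(** Uniqueness makes every fixed density scalar, which is [prim]. The traceless matrix
    [X - depolarizing X] then decays, while its scalar part is fixed. *)
Lemma primitive_limit : primitive tau -> tends_to_depolarizing tau.
Proof.
move=> [rho [_ _ _ uniq]] X; apply/cvg_hsnP => e e0.
have prim Y : psd Y -> \tr Y = 1 -> (forall t, 0 <= t -> tau t Y = Y) ->
    exists c, Y = c *: 1%:M.
  move=> Yp Y1 /invariantP fY; exists (d%:R^-1); rewrite (uniq Y) //.
  by rewrite (uniq _ density_max_mixed invariant_max_mixed).
have tr0 : \tr (X - depolarizing X) = 0.
  by rewrite raddfB /= mxtraceZ mxtrace1 divfK // subrr.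
have [t0 t00 H] := trace0_decay le_rc rc_nc tau0 tauD tau2 tau1 tau_tr tauL
  (@cisD R) (@cis_norm R) (@cis_deriv R) (@cis0 R) (@cis_neq1 R) prim tr0 e0.
exists t0; split; first exact: num_real.
move=> t tt; have t1 : 0 <= t by rewrite ltW // (lt_trans t00).
have := H t (ltW tt); rewrite (hsnBC le_rc rc_nc) linearB.
by rewrite /depolarizing linearZ /= tau1.
Qed.

End Equivalences.

(** [near_depol_mixed] asks for smallness only on finitely many frame matrices, so pointwise
    convergence provides one time valid for all of them. *)
Lemma limit_mixed_twisted_dephasing (R : realType) (d' : nat)
    (tau : R -> {linear 'M[R[i]]_d'.+1 -> 'M[R[i]]_d'.+1}) :
  quantum_markov_semigroup tau -> (forall t, 0 <= t -> trace_preserving (tau t)) ->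
  tends_to_depolarizing tau -> eventually_has (@mixed_twisted_dephasing R d'.+1) tau.
Proof.
move=> htau htp lim; set d := d'.+1.
have le_rc := @real_complex_le R; have rc_nc := @real_complex_normc R.
have tau2 (t : R) : 0 <= t -> forall Z : 'M[R[i]]_(d * 2), psd Z -> psd (tmap (tau t) Z).
  by move=> t0 Z Zp; case: htau => _ /(_ t t0)[_ cp]; exact: (cp 2).
have [e e0 He] := near_depol_mixed R[i] d'.
pose G := @frame_mx R[i] d'.
pose N := @hsn R R[i] (@Normc.normc R) d.
(* A positive common bound for the frame norms: by Cauchy-Schwarz, a defect of norm at most
   [Re e / b] makes every pairing at most [e]. *)
pose b := 1 + \sum_q N (G q).
have Gb q : N (G q) <= b.
  rewrite /b (bigD1 q) //= addrCA lerDl addr_ge0 // sumr_ge0 // => q' _.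
  exact: (hsn_ge0 le_rc rc_nc).
have b0 : 0 < b by rewrite ltr_pwDl // sumr_ge0 // => q _; exact: (hsn_ge0 le_rc rc_nc).
have e1 : 0 < complex.Re e by move: e0; rewrite ltcE => /andP[].
have near q : exists M, forall t, M < t -> N (depolarizing (G q) - tau t (G q)) <= complex.Re e / b.
  have /cvg_hsnP/(_ _ (divr_gt0 e1 b0)) := lim (G q).
  by move=> [M [_ H]]; exists M.
have [M HM] := choice near.
(* A time beyond all the thresholds [M q] at once. *)
pose t0 := 1 + \sum_q `|M q|.
have t00 : 0 < t0 by rewrite ltr_pwDl // sumr_ge0.
exists t0 => // t tt; have tp : 0 <= t by rewrite (le_trans _ tt) // ltW.
have [||Y|q q'|m [p [U [V [p0 p1 UV E]]]]] := He (depol_defect (tau t)).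
- case: htau => _ /(_ t tp)[u _]; rewrite /= /depol_defect u.
  by rewrite /depol mxtrace1 divff ?pnatr_eq0 // scale1r subrr.
- by move=> Y; rewrite /= /depol_defect raddfB /= trace_depol htp // subrr.
- rewrite /= /depol_defect adjmxB (tau_adj tau2) // /depol adjmxZ adjmx1.
  by rewrite rmorphM fmorphV rmorph_nat /= conj_trace.
- rewrite -rc_nc; have -> : e = (complex.Re e)%:C by rewrite RRe_real // ger0_real // ltW.
  rewrite lecR -[frame_mx _ q']frame_mx_herm.
  apply: le_trans (hsn_hs le_rc rc_nc _ _) _.
  have le1 : N (depol_defect (tau t) (G q)) <= complex.Re e / b.
    rewrite /depol_defect /N (hsnBC le_rc rc_nc); apply: HM.
    apply: lt_le_trans tt; rewrite /t0 (bigD1 q) //=.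
    apply: le_lt_trans (ler_norm _) _; rewrite addrCA ltrDl ltr_pwDl //.
    exact: sumr_ge0.
  have -> : complex.Re e = b * (complex.Re e / b) by rewrite mulrC divfK // lt0r_neq0.
  by apply: ler_pM (Gb q') le1; exact: (hsn_ge0 le_rc rc_nc).
have pE j : (complex.Re (p j))%:C = p j by rewrite RRe_real // ger0_real.
exists m, (fun j => complex.Re (p j)), U, V; split=> //.
- by move=> j; rewrite -ler0c pE.
- apply: (@complexI R); transitivity (\sum_j p j); last exact: p1.
  by rewrite rmorph_sum; apply: eq_bigr => j _; exact: pE.
move=> X; transitivity (depol X + depol_defect (tau t) X).
  by rewrite /depol_defect addrC subrK.
rewrite [LHS]E; apply: eq_bigr => j _.
by rewrite pE twisted_dephasingE.
Qed.

Theorem theorem7p6 (R : realType) (d : nat) (hd : (0 < d)%N)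
    (tau : R -> {linear 'M[R[i]]_d -> 'M[R[i]]_d})
    (L : {linear 'M[R[i]]_d -> 'M[R[i]]_d})
    (htau : quantum_markov_semigroup tau)
    (htp : forall t, 0 <= t -> trace_preserving (tau t))
    (hL : generator tau L) :
  [<-> eventually_has (@mixed_twisted_dephasing R d) tau;
       eventually_has (@entanglement_breaking R d) tau;
       eventually_has (@PPT R d) tau;
       eventually_has (@copositive R d 2) tau;
       peripheral_poisson_boundary L = [set c *: 1%:M | c in [set: R[i]]];
       primitive tau;
       tends_to_depolarizing tau].
Proof.
tfae.
- by move=> [t0 t00 H]; exists t0 => // t /H; exact: mixed_twisted_dephasing_EB.
- by move=> [t0 t00 H]; exists t0 => // t /H; exact: EB_PPT.
- by move=> [t0 t00 H]; exists t0 => // t /H; exact: PPT_copositive2.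
- exact: (copositive_boundary htau htp hL).
- exact: (boundary_primitive hd htau htp hL).
- exact: (primitive_limit hd htau htp hL).
case: d hd tau L htau htp {hL} => // d' _ tau L htau htp.
exact: limit_mixed_twisted_dephasing.
Qed.
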